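(* For degenerate Kundt metrics in dimension $n=3$, the derivations $$\nabla_1=\frac{I_1}{I_{2a}I_{2b}}\cdot\frac{Q}{W_v}\,\mathcal{D}_v,\qquad \nabla_2=\frac{1}{W_v}\left(\mathcal{D}_x-\frac{K_{2a}}{I_{2a}}W\,\mathcal{D}_v\right),$$ $$\nabla_3=\frac{2I_{2a}}{I_1}\cdot\frac{1}{QW_v}\left(K_{2b}W\,\mathcal{D}_x-I_{2b}h\,\mathcal{D}_u+R\,\mathcal{D}_v\right)$$ are invariant with respect to $\mathcal{G}$, and they are independent on a Zariski open subset of $\tilde{\mathcal{E}}^2$. Here $$I_1=\frac{W_v^2}{h},\quad I_{2a}=H_{vv},\quad I_{2b}=\frac{W_vh_x-2hW_{xv}}{h^2},\quad K_{2a}=\frac{H_{xv}-W_{uv}}{W},\quad K_{2b}=\frac{W_vh_u-2hW_{uv}}{Wh},$$ $$Q=\frac{(2I_{2a}K_{2b}+I_{2b}K_{2a}-I_{2a}I_{2b})W}{I_1},\qquad R=\frac{I_{2b}HW_v^2}{I_1}-\frac{\left(I_{2b}I_{2a}^2-2K_{2a}(I_{2b}-2K_{2b})I_{2a}+I_{2b}K_{2a}^2\right)W^2}{4I_{2a}^2}.$$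
   Context: Three-dimensional degenerate Kundt metrics in adapted coordinates $(u,x,v)$ are $g=du\,(dv+H\,du+W\,dx)+h\,dx^2$ with $H,W$ functions of $(u,x,v)$, $h=h(u,x)>0$, $W_{vv}=0$, $H_{vvv}=0$. Let $\pi$ be the trivial bundle over $\mathbb{R}^3(u,x,v)$ with fiber coordinates $H,W,h$ ($h>0$). $\tilde{\mathcal{E}}^k\subset J^k\pi$ is given by those of the equations $h_v=0$, $W_{vv}=0$, $H_{vvv}=0$ and all their total derivatives that have order $\le k$; $\tilde{\mathcal{E}}^\infty$ is the infinite prolongation. $\mathcal{G}$ is the Lie pseudogroup of local diffeomorphisms $(u,x,v)\mapsto(C(u),A(u,x),v/C'(u)+B(u,x))$ with $A_x\neq0$, $C'\ne0$; it acts on metrics $du(dv+Hdu+Wdx)+h\,dx^2$, hence on $J^0\pi$ (so that $g$, viewed as a horizontal symmetric 2-form on $\pi$, is invariant), and the action prolongs to jets preserving $\tilde{\mathcal{E}}^k$. Subscripts on $H,W,h$ denote jet variables; $\mathcal{D}_u,\mathcal{D}_x,\mathcal{D}_v$ are the total derivatives (restricted to $\tilde{\mathcal{E}}^\infty$). An invariant derivation is a horizontal vector field (combination of total derivatives with coefficients functions on some $\tilde{\mathcal{E}}^r$) invariant under the prolonged action of $\mathcal{G}$. ''Zariski open'' means nonempty Zariski open (in the fibers over $J^0\pi$). *)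

(* Defs.v *)
From HB Require Import structures.
From mathcomp Require Import all_boot all_order all_algebra.
From mathcomp Require Import all_classical all_reals all_analysis.
From mathcomp Require Import ring.
From mathcomp Require mpoly.

Set Implicit Arguments.
Unset Strict Implicit.
Unset Printing Implicit Defensive.

Import Order.TTheory GRing.Theory Num.Theory.
Import numFieldNormedType.Exports.

Local Open Scope classical_set_scope.
Local Open Scope ring_scope.

(* Positions of the base coordinates u, x, v in a row vector. *)
Definition iu : 'I_3 := 0.
Definition ix : 'I_3 := 1.
Definition iv : 'I_3 := 2.

(* Positions of the fibre coordinates H, W, h of pi in a row vector. *)
Definition fH : 'I_3 := 0.
Definition fW : 'I_3 := 1.
Definition fh : 'I_3 := 2.

Definition row3 (R : realType) (a b c : R) : 'rV[R]_3 :=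
  \row_i [:: a; b; c]`_i.

(* For V finite-dimensional and U open this is C^infinity on U: all iterated
   directional derivatives exist and are Frechet differentiable. *)
Definition smooth_on (R : realType) (V W : normedModType R) (U : set V)
    (f : V -> W) : Prop :=
  forall (l : seq V) (x : V), U x ->
    differentiable (foldr (fun (v : V) (g : V -> W) => 'D_v g) f l) x.

(* A multi-index (i, j, l) stands for the derivative d_u^i d_x^j d_v^l. *)
Notation mindex := (nat * nat * nat)%type.

Definition mdeg (n : mindex) : nat := (n.1.1 + n.1.2 + n.2)%N.

Definition mincr (i : 'I_3) (n : mindex) : mindex :=
  ((n.1.1 + (i == iu))%N, (n.1.2 + (i == ix))%N, (n.2 + (i == iv))%N).

Definition pder (R : realType) (n : mindex) (f : 'rV[R]_3 -> R)
    : 'rV[R]_3 -> R :=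
  let d (i : 'I_3) (g : 'rV[R]_3 -> R) := 'D_(delta_mx 0 i : 'rV[R]_3) g in
  iter n.1.1 (d iu) (iter n.1.2 (d ix) (iter n.2 (d iv) f)).

(* The multi-indices of degree at most k. *)
Definition midx (k : nat) : finType :=
  {t : 'I_k.+1 * 'I_k.+1 * 'I_k.+1 | (t.1.1 + t.1.2 + t.2 <= k)%N}.

Definition mexp (k : nat) (s : midx k) : mindex :=
  (nat_of_ord (val s).1.1, nat_of_ord (val s).1.2, nat_of_ord (val s).2).

(* k-jets of maps R^3 -> R^3: the base point, and a matrix whose rows are
   indexed by H, W, h and whose columns are indexed (through enum_rank) by the
   multi-indices of degree at most k.  The condition h > 0 defining J^k pi is
   imposed separately, by [Jpi]. *)
Definition jet (R : realType) (k : nat) : normedModType R :=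
  ('rV[R]_3 * 'M[R]_(3, #|midx k|))%type.

(* The jet coordinate a_n of th, for a one of H, W, h; it is 0 by convention if
   n has degree > k. *)
Definition jc (R : realType) (k : nat) (th : jet R k) (a : 'I_3) (n : mindex)
    : R :=
  if [pick s : midx k | mexp s == n] is Some s then th.2 a (enum_rank s) else 0.

Definition Jpi (R : realType) (k : nat) : set (jet R k) :=
  [set th | 0 < jc th fh (0, 0, 0)%N].

Definition jet_of (R : realType) (k : nat) (s : 'rV[R]_3 -> 'rV[R]_3)
    (p : 'rV[R]_3) : jet R k :=
  (p, \matrix_(a, c) pder (mexp (enum_val (A := midx k) c))
                          (fun q => s q 0 a) p).

(* The projection J^m -> J^k, for k <= m. *)
Definition jproj (R : realType) (k m : nat) (th : jet R m) : jet R k :=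
  (th.1, \matrix_(a, c) jc th a (mexp (enum_val (A := midx k) c))).

(* The polynomial section with k-jet th at th.1. *)
Definition taylor (R : realType) (k : nat) (th : jet R k) (q : 'rV[R]_3)
    : 'rV[R]_3 :=
  \row_a \sum_(s : midx k)
    jc th a (mexp s)
      / (((mexp s).1.1)`! * ((mexp s).1.2)`! * ((mexp s).2)`!)%:R
      * (q 0 iu - th.1 0 iu) ^+ (mexp s).1.1
      * (q 0 ix - th.1 0 ix) ^+ (mexp s).1.2
      * (q 0 iv - th.1 0 iv) ^+ (mexp s).2.

(* The equations h_v = 0, W_vv = 0, H_vvv = 0 and their total derivatives
   of order <= k, using D_u^i D_x^j D_v^l (a_n) = a_{n + (i, j, l)}. *)
Definition kundt_eq (R : realType) (k : nat) : set (jet R k) :=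
  [set th | [/\ Jpi th,
    (forall i j l : nat, (mdeg (i, j, l.+1) <= k)%N ->
       jc th fh (i, j, l.+1) = 0),
    (forall i j l : nat, (mdeg (i, j, l.+2) <= k)%N ->
       jc th fW (i, j, l.+2) = 0) &
    (forall i j l : nat, (mdeg (i, j, l.+3) <= k)%N ->
       jc th fH (i, j, l.+3) = 0)]].

Definition dbase (R : realType) (k : nat) (i : 'I_3) : jet R k :=
  (delta_mx 0 i, 0).
Definition djet (R : realType) (k : nat) (a : 'I_3) (s : midx k) : jet R k :=
  (0, delta_mx a (enum_rank s)).

(* D_i F = dF/dx^i + sum_(a, s) a_{s + 1_i} dF/da_s.  At points of the equation
   D_i is tangent to the equation, so that there D_i F depends only on the
   restriction of F to it. *)
Definition totalD (R : realType) (k : nat) (i : 'I_3) (F : jet R k -> R)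
    (th : jet R k.+1) : R :=
  'D_(dbase R k i) F (jproj k th)
  + \sum_(a < 3) \sum_(s : midx k)
      jc th a (mincr i (mexp s)) * 'D_(djet R a s) F (jproj k th).

(* The metric du (dv + H du + W dx) + h dx^2, as its Gram matrix in the
   coordinate frame; a juxtaposition of 1-forms is the symmetric product. *)
Definition symprod (R : realType) (al be : 'rV[R]_3) : 'M[R]_3 :=
  2^-1 *: (al^T *m be + be^T *m al).

Definition metric (R : realType) (y : 'rV[R]_3) : 'M[R]_3 :=
  let du : 'rV[R]_3 := delta_mx 0 iu in
  let dx : 'rV[R]_3 := delta_mx 0 ix in
  let dv : 'rV[R]_3 := delta_mx 0 iv in
  symprod du (dv + y 0 fH *: du + y 0 fW *: dx) + y 0 fh *: symprod dx dx.

Definition metric_coords (R : realType) (g : 'M[R]_3) : 'rV[R]_3 :=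
  row3 (g iu iu) (2 * g iu ix) (g ix ix).

Lemma metricK (R : realType) : cancel (@metric R) (@metric_coords R).
Proof.
move=> y; apply/rowP => -[[|[|[|//]]] lti]; rewrite !mxE /= !big_ord1 !mxE /=.
- rewrite [in RHS](_ : Ordinal lti = fH); last exact: val_inj.
  by field.
- rewrite [in RHS](_ : Ordinal lti = fW); last exact: val_inj.
  by field.
- rewrite [in RHS](_ : Ordinal lti = fh); last exact: val_inj.
  by field.
Qed.

Definition kundt_map (R : realType) (C : R -> R) (A B : R -> R -> R)
    (p : 'rV[R]_3) : 'rV[R]_3 :=
  row3 (C (p 0 iu)) (A (p 0 iu) (p 0 ix))
       (p 0 iv / derive1 C (p 0 iu) + B (p 0 iu) (p 0 ix)).

(* The elements of the pseudogroup G: diffeomorphisms between open subsets of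
   R^3, with their inverse. *)
Record kundt_diffeo (R : realType) := KundtDiffeo {
  kC : R -> R;
  kA : R -> R -> R;
  kB : R -> R -> R;
  kdom : set 'rV[R]_3;
  kcod : set 'rV[R]_3;
  kinv : 'rV[R]_3 -> 'rV[R]_3;
  kdom_open : open kdom;
  kcod_open : open kcod;
  kC_smooth : smooth_on kdom (fun p => kC (p 0 iu));
  kA_smooth : smooth_on kdom (fun p => kA (p 0 iu) (p 0 ix));
  kB_smooth : smooth_on kdom (fun p => kB (p 0 iu) (p 0 ix));
  kC_neq0 : forall p, kdom p -> derive1 kC (p 0 iu) != 0;
  kA_neq0 : forall p, kdom p -> derive1 (kA (p 0 iu)) (p 0 ix) != 0;
  kinv_smooth : smooth_on kcod kinv;
  kmap_cod : forall p, kdom p -> kcod (kundt_map kC kA kB p);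
  kinv_dom : forall q, kcod q -> kdom (kinv q);
  kmapK : forall p, kdom p -> kinv (kundt_map kC kA kB p) = p;
  kinvK : forall q, kcod q -> kundt_map kC kA kB (kinv q) = q
}.

Definition kmap (R : realType) (e : kundt_diffeo R) : 'rV[R]_3 -> 'rV[R]_3 :=
  kundt_map (kC e) (kA e) (kB e).

(* The action on sections is the push-forward of metrics, i.e. the pull-back
   along the inverse diffeomorphism; the latter is again of the form
   du (dv + H du + W dx) + h dx^2, and its H, W, h are read off.  ('J f p) acts
   on row vectors from the right. *)
Definition act_section (R : realType) (e : kundt_diffeo R)
    (s : 'rV[R]_3 -> 'rV[R]_3) (q : 'rV[R]_3) : 'rV[R]_3 :=
  let D := jacobian (kinv e) q in
  metric_coords (D *m metric (s (kinv e q)) *m D^T).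

(* The prolonged action on k-jets over [kdom e]: the k-jet at p of a section s
   goes to the k-jet at kmap e p of the transformed section.  This depends only
   on the k-jet of s, and the Taylor polynomial is taken for s. *)
Definition prolong (R : realType) (e : kundt_diffeo R) (k : nat)
    (th : jet R k) : jet R k :=
  jet_of k (act_section e (taylor th)) (kmap e th.1).

(* A horizontal vector field sum_i (hcoef i) D_i with coefficients functions
   on the r-jets, defined on the subset [hdom] of r-jets. *)
Record hfield (R : realType) (r : nat) := HField {
  hcoef : jet R r -> 'rV[R]_3;
  hdom : set (jet R r)
}.

(* For F a function on k-jets, X F is a function on m-jets for all m >= r, k+1. *)
Definition happly (R : realType) (r k m : nat) (X : hfield R r)
    (F : jet R k -> R) (th : jet R m) : R :=
  \sum_(i < 3) hcoef X (jproj r th) 0 i * totalD i F (jproj k.+1 th).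

(* The prolonged action on the infinite prolongation of the equation preserves X
   (and its domain): X (F o g) = (X F) o g for every g in G and every smooth
   function F on jets of any finite order. *)
Definition G_invariant (R : realType) (r : nat) (X : hfield R r) : Prop :=
  forall (e : kundt_diffeo R) (k m : nat) (F : jet R k -> R) (th : jet R m),
    (r <= m)%N -> (k < m)%N ->
    smooth_on (@Jpi R k) F ->
    kdom e th.1 -> kundt_eq th ->
    hdom X (jproj r th) ->
    hdom X (jproj r (prolong e th)) /\
    happly X (F \o @prolong R e k) th = happly X F (prolong e th).

Definition kundt_fiber (R : realType) (k : nat) (p y : 'rV[R]_3)
    : set (jet R k) :=
  [set th | [/\ kundt_eq th, th.1 = p &
                forall a, jc th a (0, 0, 0)%N = y 0 a]].

(* Nonempty and Zariski open in each fibre over J^0 pi: the fibres are affine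
   spaces, on which the polynomials are those in all jet coordinates. *)
Definition zariski_open (R : realType) (k : nat) (O : set (jet R k)) : Prop :=
  O `<=` @kundt_eq R k /\
  forall p y : 'rV[R]_3, 0 < y 0 fh ->
    (exists S : set (mpoly.mpoly (3 * #|midx k|) R),
       forall th, kundt_fiber p y th ->
         (O th <-> exists2 P, S P &
            mpoly.meval (fun i => mxvec th.2 0 i) P != 0)) /\
    (@kundt_fiber R k p y `&` O !=set0).

(* D_u, D_x, D_v being pointwise independent, horizontal fields are independent
   at a point iff their coefficient vectors are. *)
Definition independent_on (R : realType) (r : nat) (X : 'I_3 -> hfield R r)
    (O : set (jet R r)) : Prop :=
  forall th, O th -> (forall i, hdom (X i) th) /\
    row_free (\matrix_(i < 3) hcoef (X i) th).

Section Invariants.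
Variable R : realType.
Implicit Type th : jet R 2.

Definition jH th := jc th fH (0, 0, 0)%N.
Definition jHvv th := jc th fH (0, 0, 2)%N.
Definition jHxv th := jc th fH (0, 1, 1)%N.
Definition jW th := jc th fW (0, 0, 0)%N.
Definition jWv th := jc th fW (0, 0, 1)%N.
Definition jWxv th := jc th fW (0, 1, 1)%N.
Definition jWuv th := jc th fW (1, 0, 1)%N.
Definition jh th := jc th fh (0, 0, 0)%N.
Definition jhu th := jc th fh (1, 0, 0)%N.
Definition jhx th := jc th fh (0, 1, 0)%N.

Definition I1 th : R := jWv th ^+ 2 / jh th.
Definition I2a th : R := jHvv th.
Definition I2b th : R :=
  (jWv th * jhx th - 2 * jh th * jWxv th) / jh th ^+ 2.
Definition K2a th : R := (jHxv th - jWuv th) / jW th.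
Definition K2b th : R :=
  (jWv th * jhu th - 2 * jh th * jWuv th) / (jW th * jh th).
Definition Q th : R :=
  (2 * I2a th * K2b th + I2b th * K2a th - I2a th * I2b th) * jW th / I1 th.
Definition Rr th : R :=
  I2b th * jH th * jWv th ^+ 2 / I1 th
  - (I2b th * I2a th ^+ 2 - 2 * K2a th * (I2b th - 2 * K2b th) * I2a th
     + I2b th * K2a th ^+ 2) * jW th ^+ 2 / (4 * I2a th ^+ 2).

(* Coefficients with respect to (D_u, D_x, D_v). *)
Definition coef1 th : 'rV[R]_3 :=
  row3 0 0 (I1 th / (I2a th * I2b th) * (Q th / jWv th)).
Definition coef2 th : 'rV[R]_3 :=
  (jWv th)^-1 *: row3 0 1 (- (K2a th / I2a th * jW th)).
Definition coef3 th : 'rV[R]_3 :=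
  (2 * I2a th / I1 th * (1 / (Q th * jWv th))) *:
    row3 (- (I2b th * jh th)) (K2b th * jW th) (Rr th).

(* As rational functions of the jet coordinates these coefficients are regular
   at W = 0, since K2a and K2b occur only in K2a W and K2b W, but x / 0 = 0 gives
   the formulas a wrong value there.  Below the factor W is cancelled. *)
Definition K2aW th : R := jHxv th - jWuv th.
Definition K2bW th : R := (jWv th * jhu th - 2 * jh th * jWuv th) / jh th.
Definition Qreg th : R :=
  (2 * I2a th * K2bW th + I2b th * K2aW th - I2a th * I2b th * jW th) / I1 th.
Definition Rreg th : R :=
  I2b th * jH th * jWv th ^+ 2 / I1 th
  - (I2b th * I2a th ^+ 2 * jW th ^+ 2
     - 2 * K2aW th * (I2b th * jW th - 2 * K2bW th) * I2a th
     + I2b th * K2aW th ^+ 2) / (4 * I2a th ^+ 2).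

Definition nabla1 : hfield R 2 := HField
  (fun th => row3 0 0 (I1 th / (I2a th * I2b th) * (Qreg th / jWv th)))
  [set th | [/\ jWv th != 0, I2a th != 0 & I2b th != 0]].
Definition nabla2 : hfield R 2 := HField
  (fun th => (jWv th)^-1 *: row3 0 1 (- (K2aW th / I2a th)))
  [set th | jWv th != 0 /\ I2a th != 0].
Definition nabla3 : hfield R 2 := HField
  (fun th => (2 * I2a th / I1 th * (1 / (Qreg th * jWv th))) *:
     row3 (- (I2b th * jh th)) (K2bW th) (Rreg th))
  [set th | [/\ jWv th != 0, I2a th != 0 & Qreg th != 0]].

Definition nabla (i : 'I_3) : hfield R 2 := nth nabla1 [:: nabla1; nabla2; nabla3] i.

Lemma nablaE th : jW th != 0 ->
  [/\ hcoef nabla1 th = coef1 th, hcoef nabla2 th = coef2 th &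
      hcoef nabla3 th = coef3 th].
Proof.
move=> W0.
have Ea : K2a th * jW th = K2aW th by rewrite /K2a divfK.
have Eb : K2b th * jW th = K2bW th.
  by rewrite /K2b /K2bW invfM mulrA mulrAC divfK.
have EQ : Q th = Qreg th by rewrite /Q /Qreg -Ea -Eb; congr (_ / _); ring.
have ER : Rr th = Rreg th.
  by rewrite /Rr /Rreg -Ea -Eb; congr (_ - _ / _); ring.
by split; rewrite /= /coef1 /coef2 /coef3 ?EQ ?ER -?Ea -?Eb // mulrAC.
Qed.

End Invariants.

(* Main.v *)
Require Import Defs.
From mathcomp Require Import all_boot all_order all_algebra.
From mathcomp Require Import all_classical all_reals all_analysis.
From mathcomp Require Import ring.
From mathcomp Require mpoly.
Import (canonicals, hints) mpoly.

(* On the jet of a section s, the total derivative D_i of F o g is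
   sum_j d_i phi^j (D_j F) o g, where phi is the underlying diffeomorphism of
   R^3: indeed (F o g)(j s) = F(j (g s)) o phi, so this is the chain rule.
   Hence X = sum_i X^i D_i is invariant as soon as its coefficients transform
   as the components of a vector field, sum_i X^i d_i phi^j = X^j o g.  The
   transformation of the 2-jet coordinates entering the nabla_i is computed from
     H' = H/C'^2 - W A_u/(C'^2 A_x) + (A_u B_x/A_x - b)/C' + h A_u^2/(C'^2 A_x^2),
     W' = W/(C' A_x) - B_x/A_x - 2 h A_u/(C' A_x^2),    h' = h/A_x^2,
   with b = B_u - v C''/C'^2, and gives I1, I2a, I2b invariant, W_v' = W_v/A_x and
     Q' = Q/(C' A_x),    (K2a W)' = (K2a W/C' - I2a B_x)/A_x,
     (K2b W)' = K2b W/(C' A_x) - I2b h A_u/(C' A_x^2),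
     R' = (R/C' + K2b W B_x - I2b h b)/(C' A_x^2),
   from which the covariance of the coefficients is immediate.  The nabla_i are
   triangular, hence independent where W_v, I2a, I2b and Q do not vanish. *)

Set Implicit Arguments.
Unset Strict Implicit.
Unset Printing Implicit Defensive.

Import Order.TTheory GRing.Theory Num.Theory.
Import numFieldNormedType.Exports.

Local Open Scope classical_set_scope.
Local Open Scope ring_scope.

(** * Smooth functions *)

(** Differentiability is local: the first-order expansion of [f] at [x] is also one of [g], and
    [diff_unique] then identifies the differential of [g]. *)
Lemma near_eq_differentiable (R : realType) (V W : normedModType R)
    (f g : V -> W) (x : V) :
  (\near x, f x = g x) -> differentiable f x -> differentiable g x.
Proof.
move=> fg df.
have fgx : f x = g x by exact: (nbhs_singleton fg).
have e : g \o shift x = cst (g x) + 'd f x +o_ (0 : V) id.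
  apply/eqaddoP => _ /posnumP[eps].
  have /eqaddoP /(_ eps%:num) /(_ [gt0 of eps%:num]) := diff_locally df.
  have fg' : \forall h \near (0 : V), f (h + x) = g (h + x).
    by move: fg; rewrite (near_shift 0 x) /=; apply: filterS => y; rewrite subr0.
  apply: filter_app; near=> h.
  rewrite -![(_ + _ : _ -> _) _]/(_ + _) -![(- _ : _ -> _) _]/(- _) /= /cst.
  by rewrite fgx (near fg' h).
apply/diff_locallyP; have -> := diff_unique (diff_continuous df) e.
by split=> //; exact: diff_continuous.
Unshelve. all: by end_near. Qed.

(** The two groupings of a mixed second difference; [a] and [a'] are the value at the far corner,
    reached along the edges in either order. *)
Lemma second_difference_sym (R : zmodType) (a a' b c d x y : R) : a = a' ->
  a - b - (c - d) = x -> a' - c - (b - d) = y -> x = y.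
Proof.
move=> <- <- <-; rewrite !opprB -!addrA; congr (_ + _).
by rewrite addrCA [RHS]addrCA; congr (_ + _); rewrite addrC.
Qed.

Lemma dist_lt_split (R : realType) (a b c e : R) :
  `|a - b| < e / 2 -> `|b - c| < e / 2 -> `|a - c| < e.
Proof.
move=> ab bc; apply: le_lt_trans (ler_distD b a c) _.
by rewrite [e]splitr ltrD.
Qed.

Section Smooth.
Variables (R : realType) (V : normedModType R).
Implicit Types (U : set V) (f g : V -> R).

Lemma smooth_diff (W : normedModType R) U (f : V -> W) x :
  smooth_on U f -> U x -> differentiable f x.
Proof. by move=> /(_ [::]); apply. Qed.

Lemma smooth_derive (W : normedModType R) U (f : V -> W) v :
  smooth_on U f -> smooth_on U ('D_v f).
Proof. by move=> sf l x Ux; have := sf (rcons l v) x Ux; rewrite foldr_rcons. Qed.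

(** A coinduction principle for smoothness. Derivatives have to return to the class only up to
    equality on [U], since derivation rules are available only there. *)
Lemma smooth_coind (W : normedModType R) U (P : (V -> W) -> Prop) (f : V -> W) :
  open U ->
  (forall f : V -> W, P f -> forall x, U x -> differentiable f x) ->
  (forall (f : V -> W) v, P f -> exists2 g : V -> W, P g & forall x, U x -> 'D_v f x = g x) ->
  P f -> smooth_on U f.
Proof.
move=> oU Pd PD Pf l.
(* Generalising to functions equal to [f] on [U] allows ['D_v f] to be replaced by its
   representative in the class. The induction removes the last vector of [l], which is the innermost
   derivative. *)
suff H (g : V -> W) : (forall x, U x -> g x = f x) -> forall x, U x ->
    differentiable (foldr (fun (v : V) (g : V -> W) => 'D_v g) g l) x.
  exact: H.
elim/last_ind: l f Pf g => [|l v IH] f Pf g gf x Ux /=.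
  apply: (@near_eq_differentiable _ _ _ f g x); last exact: Pd.
  by apply: filterS (open_nbhs_nbhs (conj oU Ux)) => y /gf.
rewrite foldr_rcons; have [f' Pf' ff'] := PD f v Pf.
apply: (IH f' Pf') => // y Uy; rewrite -ff' //.
apply: near_eq_derive.
by apply: filterS (open_nbhs_nbhs (conj oU Uy)) => z /gf.
Qed.

(** The derivative of a product is a sum of products, so sums and products are treated together: by
    the Leibniz rule this algebra is stable under derivation. *)
Inductive smooth_alg U : (V -> R) -> Prop :=
| SAbase f of smooth_on U f : smooth_alg U f
| SAadd f g of smooth_alg U f & smooth_alg U g : smooth_alg U (fun x => f x + g x)
| SAmul f g of smooth_alg U f & smooth_alg U g : smooth_alg U (fun x => f x * g x).

Lemma smooth_alg_diff U f : smooth_alg U f ->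
  forall x, U x -> differentiable f x.
Proof.
elim=> {f} [f sf x|f g _ df _ dg x Ux|f g _ df _ dg x Ux].
- exact: smooth_diff.
- by apply: (@differentiableD _ _ _ f g); [exact: df|exact: dg].
- by apply: (@differentiableM _ _ f g); [exact: df|exact: dg].
Qed.

Lemma smooth_alg_smooth U f : open U -> smooth_alg U f -> smooth_on U f.
Proof.
move=> oU; apply: smooth_coind => //; first exact: smooth_alg_diff.
move=> {}f v; elim=> {f} [f sf|f g saf [f' f'P ff'] sag [g' g'P gg']|
    f g saf [f' f'P ff'] sag [g' g'P gg']].
- by exists ('D_v f) => //; apply/SAbase/smooth_derive.
- exists (fun x => f' x + g' x); first exact: SAadd.
  move=> x Ux; rewrite -ff' // -gg' //.
  by apply: (@deriveD _ _ _ f g); apply: diff_derivable;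
    [exact: (smooth_alg_diff saf)|exact: (smooth_alg_diff sag)].
- exists (fun x => f x * g' x + g x * f' x).
    by apply: SAadd; apply: SAmul.
  move=> x Ux; rewrite -ff' // -gg' //.
  by apply: (@deriveM _ _ f g); apply: diff_derivable;
    [exact: (smooth_alg_diff saf)|exact: (smooth_alg_diff sag)].
Qed.

Lemma smoothD U f g : open U -> smooth_on U f -> smooth_on U g ->
  smooth_on U (fun x => f x + g x).
Proof. by move=> oU sf sg; apply/smooth_alg_smooth/SAadd; first by []; exact: SAbase. Qed.

Lemma smoothM U f g : open U -> smooth_on U f -> smooth_on U g ->
  smooth_on U (fun x => f x * g x).
Proof. by move=> oU sf sg; apply/smooth_alg_smooth/SAmul; first by []; exact: SAbase. Qed.

Lemma smooth_cst U (c : R) : open U -> smooth_on U (fun=> c).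
Proof.
move=> oU; apply: (@smooth_coind _ _ (fun f => exists c, f = fun=> c)) => //.
- by move=> _ [d ->] x _; exact: differentiable_cst.
- move=> _ v [d ->]; exists (fun=> 0); first by exists 0.
  by move=> x _; exact: derive_cst.
- by exists c.
Qed.

Lemma smooth_sum U (I : Type) (r : seq I) (F : I -> V -> R) : open U ->
  (forall i, smooth_on U (F i)) -> smooth_on U (fun x => \sum_(i <- r) F i x).
Proof.
move=> oU sF; elim: r => [|i r IH].
  by under eq_fun do rewrite big_nil; exact: smooth_cst.
by under eq_fun do rewrite big_cons; exact: smoothD.
Qed.

Lemma smoothX U f n : open U -> smooth_on U f -> smooth_on U (fun x => f x ^+ n).
Proof.
move=> oU sf; elim: n => [|n IH].
  by under eq_fun do rewrite expr0; exact: smooth_cst.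
by under eq_fun do rewrite exprS; exact: smoothM.
Qed.

Lemma MVT_line f (x v : V) (h : R) : 0 < h ->
  (forall t, 0 <= t <= h -> differentiable f (x + t *: v)) ->
  exists2 c, 0 < c < h & f (x + h *: v) - f x = h * 'D_v f (x + c *: v).
Proof.
move=> h0 df.
have dg t : 0 <= t <= h ->
    is_derive t 1 (fun t : R => f (x + t *: v)) ('D_v f (x + t *: v)).
  move=> th.
  have dl : is_diff t (fun t : R => x + t *: v) (fun t => t *: v).
    by apply: is_diff_eq; rewrite add0r.
  have d : differentiable (f \o (fun t : R => x + t *: v)) t.
    by apply: differentiable_comp => //; exact: df.
  apply: DeriveDef; first exact: diff_derivable.
  rewrite (_ : (fun t => _) = f \o (fun t : R => x + t *: v)) //.
  rewrite deriveE // diff_comp //; last exact: df.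
  by rewrite /= diff_val scale1r deriveE //; exact: df.
have [||c cab e] := @MVT R (fun t => f (x + t *: v)) (fun t => 'D_v f (x + t *: v)) 0 h h0.
- by move=> t; rewrite in_itv /= => /andP[t0 th]; apply: dg; rewrite !ltW.
- apply: continuous_in_subspaceT => t; rewrite inE /= in_itv /= => th.
  apply: differentiable_continuous; apply/derivable1_diffP.
  by have [] := dg t th.
- exists c; first by move: cab; rewrite in_itv.
  by move: e; rewrite scale0r addr0 subr0 mulrC.
Qed.

(* Both iterated derivatives are limits of the same second difference. *)
Lemma derive_second_difference f (x v w : V) (h : R) U : 0 < h ->
  smooth_on U f ->
  (forall s t, 0 <= s <= h -> 0 <= t <= h -> U (x + s *: v + t *: w)) ->
  exists s t, [/\ 0 <= s <= h, 0 <= t <= h &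
    f (x + h *: v + h *: w) - f (x + h *: v) - (f (x + h *: w) - f x) =
    h ^+ 2 * 'D_w ('D_v f) (x + s *: v + t *: w)].
Proof.
move=> h0 sf Uh; have h00 : 0 <= h <= h by apply/andP; split => //; exact: ltW.
have z0 : 0 <= (0 : R) <= h by apply/andP; split => //; exact: ltW.
(* The mean value theorem is applied to [g] along [v], which gives [s], and then to ['D_v f] along
   [w], which gives [t]. *)
pose g y := f (y + h *: w) - f y.
have dg1 y : U y -> U (y + h *: w) -> is_derive y v g ('D_v f (y + h *: w) - 'D_v f y).
  move=> Uy Uyh.
  have d1 : derivable f y v by apply/diff_derivable/(smooth_diff sf).
  have dl : is_diff y (fun y : V => y + h *: w) id.
    by apply: is_diff_eq; rewrite addr0.
  have d2 : differentiable f (y + h *: w) by exact/(smooth_diff sf).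
  have d3 : differentiable (f \o (fun y : V => y + h *: w)) y.
    exact: differentiable_comp.
  have : is_derive y v (f \o (fun y : V => y + h *: w)) ('D_v f (y + h *: w)).
    apply: DeriveDef; first exact: diff_derivable.
    by rewrite deriveE // diff_comp //= diff_val deriveE.
  by move=> d4; apply: is_deriveB.
have Ub s : 0 <= s <= h -> U (x + s *: v).
  by move=> sh; have := Uh s 0 sh z0; rewrite scale0r addr0.
have [|s sh e1] := @MVT_line g x v h h0.
  move=> t th; apply: (@differentiableB _ _ _ (fun y => f (y + h *: w)) f).
    apply: (@differentiable_comp _ _ _ _ (fun y => y + h *: w) f) => //.
    by apply/(smooth_diff sf)/Uh.
  exact/(smooth_diff sf)/Ub.
have sh' : 0 <= s <= h by case/andP: sh => ? ?; rewrite !ltW.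
have [|t th e2] := @MVT_line ('D_v f) (x + s *: v) w h h0.
  by move=> t th; apply: (smooth_diff (smooth_derive v sf)); exact: Uh.
exists s, t; split=> //; first by case/andP: th => ? ?; rewrite !ltW.
rewrite -[LHS]/(g (x + h *: v) - g x) e1.
have [_ ->] := dg1 _ (Ub _ sh') (Uh _ _ sh' h00).
by rewrite e2 mulrA expr2.
Qed.

(** On a small parallelogram the second difference is [h ^+ 2] times either mixed derivative at some
    point of it. Both are continuous at [x], so their values there differ by less than any [e]. *)
Lemma derive_comm U f (x v w : V) : open U -> smooth_on U f -> U x ->
  'D_v ('D_w f) x = 'D_w ('D_v f) x.
Proof.
move=> oU sf Ux; apply/eqP; rewrite -subr_eq0 -normr_le0.
apply/ler_addgt0Pl => e e0; rewrite addr0.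
have e20 : 0 < e / 2 by rewrite divr_gt0.
have near_line (g : V -> R) : {for x, continuous g} ->
    nbhs ((0, 0) : R * R) [set z | U (x + z.1 *: v + z.2 *: w) /\
      `|g x - g (x + z.1 *: v + z.2 *: w)| < e / 2].
  move=> cg.
  have c : (fun z : R * R => x + z.1 *: v + z.2 *: w) @ nbhs ((0, 0) : R * R) --> x.
    rewrite -[X in _ --> X](_ : x + 0 *: v + 0 *: w = x); last first.
      by rewrite !scale0r !addr0.
    apply: cvgD; first apply: cvgD; first exact: cvg_cst.
      by apply: cvgZl; exact: cvg_fst.
    by apply: cvgZl; exact: cvg_snd.
  apply: filterI.
    exact: (c _ (open_nbhs_nbhs (conj oU Ux))).
  have /cvgrPdist_lt/(_ _ e20) := cg; exact: c.
have cD v1 v2 : {for x, continuous ('D_v1 ('D_v2 f))}.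
  apply: differentiable_continuous.
  exact: (smooth_diff (smooth_derive _ (smooth_derive _ sf)) Ux).
have /nbhs_ballP[d /= d0 dP] :=
  @filterI _ _ (nbhs_filter _) _ _ (near_line _ (cD v w)) (near_line _ (cD w v)).
(* Half the radius, so that the closed square of side [h] lies in the open ball. *)
pose h := d / 2; have h0 : 0 < h by rewrite divr_gt0.
have hd : h < d by rewrite /h ltr_pdivrMr // ltr_pMr // ltr1n.
have inb s t : 0 <= s <= h -> 0 <= t <= h -> ball ((0 : R), (0 : R)) d (s, t).
  move=> /andP[s0 sh] /andP[t0 th]; split; rewrite /ball /= sub0r normrN ger0_norm //;
  exact: le_lt_trans hd.
have Uvw s t : 0 <= s <= h -> 0 <= t <= h -> U (x + s *: v + t *: w).
  by move=> sh th; have [[]] := dP _ (inb s t sh th).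
have Uwv s t : 0 <= s <= h -> 0 <= t <= h -> U (x + s *: w + t *: v).
  by move=> sh th; rewrite addrAC; exact: Uvw.
have [s1 [t1 [s1h t1h e1]]] := derive_second_difference h0 sf Uvw.
have [s2 [t2 [s2h t2h e2]]] := derive_second_difference h0 sf Uwv.
have e12 : 'D_w ('D_v f) (x + s1 *: v + t1 *: w) = 'D_v ('D_w f) (x + s2 *: w + t2 *: v).
  have h2 : h ^+ 2 != 0 by rewrite expf_neq0 // gt_eqF.
  have hA : f (x + h *: v + h *: w) = f (x + h *: w + h *: v) by rewrite addrAC.
  apply: (mulfI h2); exact: second_difference_sym hA e1 e2.
have [[_ b1] _] := dP _ (inb _ _ t2h s2h).
have [_ [_ b2]] := dP _ (inb _ _ s1h t1h).
have hB : x + t2 *: v + s2 *: w = x + s2 *: w + t2 *: v by rewrite addrAC.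
rewrite /= hB in b1; rewrite /= e12 distrC in b2.
exact: ltW (dist_lt_split b1 b2).
Qed.

End Smooth.

Notation pd i f := ('D_(delta_mx 0 i : 'rV[_]_3) f).

(** * Rules for directional derivatives of scalar functions *)

Section DeriveRules.
Variables (R : realType) (V : normedModType R).
Implicit Types (f g : V -> R) (x v : V).

Lemma is_derive_add f g x v (df dg : R) :
  is_derive x v f df -> is_derive x v g dg ->
  is_derive x v (fun y => f y + g y) (df + dg).
Proof. by move=> ? ?; apply: (@is_deriveD _ _ _ f g). Qed.

Lemma is_derive_opp f x v (df : R) :
  is_derive x v f df -> is_derive x v (fun y => - f y) (- df).
Proof. by move=> ?; apply: (@is_deriveN _ _ _ f). Qed.

Lemma is_derive_mul f g x v (df dg : R) :
  is_derive x v f df -> is_derive x v g dg ->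
  is_derive x v (fun y => f y * g y) (df * g x + f x * dg).
Proof.
move=> dff dgg; apply: is_derive_eq (is_deriveM dff dgg) _.
by rewrite addrC /GRing.scale /= [g x * _]mulrC.
Qed.

Lemma is_derive_sqr f x v (df : R) : is_derive x v f df ->
  is_derive x v (fun y => f y ^+ 2) (2 * f x * df).
Proof.
by move=> dff; apply: is_derive_eq (is_derive_mul dff dff) _; ring.
Qed.

Lemma is_derive_inv f x v (df : R) : is_derive x v f df -> f x != 0 ->
  is_derive x v (fun y => (f y)^-1) (- df / f x ^+ 2).
Proof.
move=> [dff <-] fx0; apply: DeriveDef; first exact: derivableV.
by rewrite deriveV // /GRing.scale /= mulrC mulrN mulNr.
Qed.

Lemma is_derive_diff f x v : differentiable f x -> is_derive x v f ('D_v f x).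
Proof. by move=> df; apply: DeriveDef => //; exact: diff_derivable. Qed.

End DeriveRules.

(** * Differentiation of matrix-valued maps and the chain rule in coordinates *)

Section Coordinates.
Variable R : realType.
Local Notation P := 'rV[R]_3.

Lemma case3 (T : 'I_3 -> Prop) : T iu -> T ix -> T iv -> forall i, T i.
Proof.
move=> T0 T1 T2 [[|[|[|//]]] lti].
- by rewrite (_ : Ordinal lti = iu) //; exact: val_inj.
- by rewrite (_ : Ordinal lti = ix) //; exact: val_inj.
- by rewrite (_ : Ordinal lti = iv) //; exact: val_inj.
Qed.

Lemma sum3 (V : nmodType) (F : 'I_3 -> V) : \sum_(i < 3) F i = F iu + F ix + F iv.
Proof.
rewrite !big_ord_recl big_ord0 addr0 addrA.
by congr (F _ + F _ + F _); exact: val_inj.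
Qed.

Lemma row3E (a b c : R) :
  (row3 a b c 0 iu = a) * (row3 a b c 0 ix = b) * (row3 a b c 0 iv = c).
Proof. by rewrite !mxE. Qed.

Lemma differentiable_mx (V : normedModType R) m n (f : V -> 'M[R]_(m, n)) x :
  (forall i j, differentiable (fun y => f y i j) x) -> differentiable f x.
Proof.
move=> df.
have -> : f = \sum_(i < m) \sum_(j < n) (fun y => f y i j *: delta_mx i j).
  apply/funext => y; rewrite [LHS]matrix_sum_delta !fct_sumE.
  by apply: eq_bigr => i _; rewrite !fct_sumE.
apply: differentiable_sum => i; apply: differentiable_sum => j.
exact: differentiableZl.
Qed.

Lemma differentiable_entry (V : normedModType R) m n (f : V -> 'M[R]_(m, n)) x i j :
  differentiable f x -> differentiable (fun y => f y i j) x.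
Proof.
move=> df; apply: (@differentiable_comp _ _ _ _ f (fun M : 'M[R]_(m, n) => M i j)) => //.
exact: differentiable_coord.
Qed.

Lemma derive_entry (V : normedModType R) m n (f : V -> 'M[R]_(m, n)) x v i j :
  differentiable f x -> 'D_v (fun y => f y i j) x = 'D_v f x i j.
Proof. by move=> df; rewrite derive_mx ?mxE //; exact: diff_derivable. Qed.

Lemma smooth_entry (V : normedModType R) m n (U : set V) (f : V -> 'M[R]_(m, n)) i j :
  open U -> smooth_on U f -> smooth_on U (fun y => f y i j).
Proof.
move=> oU sf.
apply: (@smooth_coind _ _ _ U
  (fun g => exists2 f : V -> 'M[R]_(m, n), smooth_on U f & g = fun y => f y i j)) => //.
- move=> _ [{}f {}sf ->] x Ux; apply: differentiable_entry; exact: (smooth_diff sf).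
- move=> _ v [{}f {}sf ->]; exists (fun y => 'D_v f y i j).
    by exists ('D_v f) => //; exact: smooth_derive.
  by move=> x Ux; rewrite derive_entry //; exact: (smooth_diff sf).
- by exists f.
Qed.

Lemma is_derive_coord (p v : P) j : is_derive p v (fun q : P => q 0 j) (v 0 j).
Proof.
have d : differentiable (fun q : P => q 0 j) p by exact: differentiable_coord.
apply: DeriveDef; first exact: diff_derivable.
by rewrite (@derive_entry _ _ _ id) // derive_id.
Qed.

Lemma smooth_coord (U : set P) j : open U -> smooth_on U (fun q : P => q 0 j).
Proof.
move=> oU.
apply: (@smooth_coind _ _ _ U (fun f => f = (fun q : P => q 0 j) \/ exists c, f = cst c)) => //.
- move=> _ [->|[c ->]] x _; last exact: differentiable_cst.
  exact: differentiable_coord.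
- move=> f v [->|[c ->]].
    exists (cst (v 0 j)); first by right; exists (v 0 j).
    by move=> x _; have [] := is_derive_coord x v j.
  exists (cst 0); first by right; exists 0.
  by move=> x _; exact: derive_cst.
- by left.
Qed.

Lemma derive_chain (V : normedModType R) (f : V -> P) (g : P -> R) x v :
  differentiable f x -> differentiable g (f x) ->
  'D_v (fun y => g (f y)) x = \sum_(j < 3) 'D_v f x 0 j * pd j g (f x).
Proof.
move=> df dg; rewrite (_ : (fun y => _) = g \o f) //.
rewrite deriveE; last exact: differentiable_comp.
rewrite diff_comp //= -(deriveE _ df); set w := 'D_v f x.
rewrite [X in 'd _ _ X](row_sum_delta w) linear_sum; apply: eq_bigr => j _.
by rewrite linearZ /= deriveE.
Qed.

Lemma is_derive_bigsum (V : normedModType R) (I : Type) (r : seq I)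
    (F : I -> V -> R) (dF : I -> R) x v :
  (forall i, is_derive x v (F i) (dF i)) ->
  is_derive x v (fun y => \sum_(i <- r) F i y) (\sum_(i <- r) dF i).
Proof.
move=> dFi; elim: r => [|i r IH].
  by under eq_fun do rewrite big_nil; rewrite big_nil; exact: is_derive_cst.
by under eq_fun do rewrite big_cons; rewrite big_cons; exact: is_deriveD.
Qed.

End Coordinates.

(** * Iterated partial derivatives and monomials *)

Section PartialDerivatives.
Variable R : realType.
Local Notation P := 'rV[R]_3.
Implicit Types (U : set P) (f g : P -> R).

Lemma smooth_iter U f n i : smooth_on U f ->
  smooth_on U (iter n (fun f : P -> R => pd i f) f).
Proof. by move=> sf; elim: n => //= n; exact: smooth_derive. Qed.

Lemma pderE n f : pder n f =
  iter n.1.1 (fun f : P -> R => pd iu f) (iter n.1.2 (fun f : P -> R => pd ix f)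
    (iter n.2 (fun f : P -> R => pd iv f) f)).
Proof. by []. Qed.

Lemma smooth_pder U f n : smooth_on U f -> smooth_on U (pder n f).
Proof. by move=> sf; rewrite pderE; do 3!apply: smooth_iter. Qed.

Lemma eq_derive_on U f g v : open U -> (forall x, U x -> f x = g x) ->
  forall x, U x -> 'D_v f x = 'D_v g x.
Proof.
move=> oU fg x Ux; apply: near_eq_derive.
by apply: filterS (open_nbhs_nbhs (conj oU Ux)) => y /fg.
Qed.

Lemma eq_iter_on U f g n i : open U -> (forall x, U x -> f x = g x) ->
  forall x, U x -> iter n (fun f : P -> R => pd i f) f x =
    iter n (fun f : P -> R => pd i f) g x.
Proof. by move=> oU fg; elim: n => //= n; exact: eq_derive_on. Qed.

Lemma pd_iter U f n i j : open U -> smooth_on U f -> forall x, U x ->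
  pd j (iter n (fun f : P -> R => pd i f) f) x =
  iter n (fun f : P -> R => pd i f) (pd j f) x.
Proof.
move=> oU sf; elim: n => //= n IH x Ux.
rewrite (derive_comm _ _ oU _ Ux); last exact: smooth_iter.
exact: eq_derive_on oU IH _ Ux.
Qed.

(** [pder] takes the v-derivatives first and the u-derivatives last, so a further derivative in x or
    v has to be commuted inwards. *)
Lemma pd_pder U f n i x : open U -> smooth_on U f -> U x ->
  pd i (pder n f) x = pder (mincr i n) f x.
Proof.
move=> oU sf; rewrite !pderE; elim/case3: i => Ux /=.
- by rewrite addn1 !addn0.
- rewrite addn1 !addn0 (pd_iter _ _ _ oU) //; by do 2!apply: smooth_iter.
- rewrite addn1 !addn0 (pd_iter _ _ _ oU) //; last by do 2!apply: smooth_iter.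
  refine (eq_iter_on _ _ oU _ Ux) => y Uy /=; rewrite (pd_iter _ _ _ oU) //.
  exact: smooth_iter.
Qed.

Definition mono (p : P) (n : mindex) (q : P) : R :=
  (q 0 iu - p 0 iu) ^+ n.1.1 * (q 0 ix - p 0 ix) ^+ n.1.2
  * (q 0 iv - p 0 iv) ^+ n.2.

Lemma monop p n : mono p n p = (n == (0, 0, 0)%N)%:R.
Proof.
case: n => -[a b] c; rewrite /mono /= !subrr !expr0n -!natrM !mulnb.
by rewrite !xpair_eqE.
Qed.

(** The subtraction is truncated; where this matters the exponent is 0, and the factor [mcoord i n]
    in [is_derive_mono] makes the term vanish. *)
Definition mdecr (i : 'I_3) (n : mindex) : mindex :=
  ((n.1.1 - (i == iu))%N, (n.1.2 - (i == ix))%N, (n.2 - (i == iv))%N).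
Definition mcoord (i : 'I_3) (n : mindex) : nat := nth 0%N [:: n.1.1; n.1.2; n.2] i.

Lemma is_derive_mono (p q : P) n i : is_derive q (delta_mx 0 i : P) (mono p n)
  ((mcoord i n)%:R * mono p (mdecr i n) q).
Proof.
have dX j (m : nat) : is_derive q (delta_mx 0 i : P)
    (fun q => (q 0 j - p 0 j) ^+ m)
    ((i == j)%:R * m%:R * (q 0 j - p 0 j) ^+ (m - (i == j))).
  have d : is_derive q (delta_mx 0 i : P) (fun q : P => q 0 j - p 0 j) (i == j)%:R.
    have := is_derive_coord q (delta_mx 0 i : P) j.
    rewrite mxE eqxx /= [j == i]eq_sym => d1.
    apply: is_derive_eq (is_deriveB d1 (is_derive_cst (p 0 j) q _)) _.
    by rewrite subr0.
  have := is_deriveX m d; rewrite exprfctE => dm; apply: (is_derive_eq dm).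
  rewrite /GRing.scale /=; case: (i == j); last by rewrite !mul0r mulr0.
  by rewrite subn1 mul1r mulr1.
rewrite /mono.
have dm := is_derive_mul (is_derive_mul (dX iu n.1.1) (dX ix n.1.2)) (dX iv n.2).
apply: (is_derive_eq dm).
elim/case3: i {dX dm}; rewrite /mcoord /mdecr /= ?subn0 ?subn1; ring.
Qed.

Lemma pd_mono_sum (I : Type) (r : seq I) (C : I -> R) (g : I -> mindex) p i :
  pd i (fun q => \sum_(s <- r) C s * mono p (g s) q) =
  (fun q => \sum_(s <- r) (C s * (mcoord i (g s))%:R) * mono p (mdecr i (g s)) q).
Proof.
apply/funext => q; apply: derive_val; apply: is_derive_bigsum => s.
have := is_deriveZ (C s) (is_derive_mono p q (g s) i).
by rewrite /GRing.scale /= mulrA.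
Qed.

Lemma iter_mono_sum (I : Type) (r : seq I) (C : I -> R) (g : I -> mindex) p i n :
  iter n (fun f : P -> R => pd i f) (fun q => \sum_(s <- r) C s * mono p (g s) q) =
  (fun q => \sum_(s <- r) (C s * (mcoord i (g s) ^_ n)%:R)
     * mono p (iter n (mdecr i) (g s)) q).
Proof.
elim: n => [|n IH] /=.
  by apply/funext => q; apply: eq_bigr => s _; rewrite ffactn0 mulr1.
rewrite IH pd_mono_sum; apply/funext => q; apply: eq_bigr => s _; congr (_ * _).
(* The new factor of the falling factorial is the exponent left after [n] decrements. *)
rewrite ffactnSr natrM mulrA; congr (_ * _%:R).
by elim/case3: i {IH}; elim: n => [|n IH]; rewrite /= ?subn0 //;
  move: IH; rewrite /mcoord /mdecr /= => ->; rewrite subn1 subnS.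
Qed.

Lemma pder_mono_sum (I : Type) (r : seq I) (C : I -> R) (g : I -> mindex) p n q :
  pder n (fun q => \sum_(s <- r) C s * mono p (g s) q) q =
  \sum_(s <- r) (C s * ((g s).1.1 ^_ n.1.1 * (g s).1.2 ^_ n.1.2 * (g s).2 ^_ n.2)%:R)
     * mono p ((g s).1.1 - n.1.1, (g s).1.2 - n.1.2, (g s).2 - n.2)%N q.
Proof.
have iterE i m k : iter k (mdecr i) m =
    ((m.1.1 - k * (i == iu))%N, (m.1.2 - k * (i == ix))%N, (m.2 - k * (i == iv))%N).
  elim: k => [|k /= ->]; first by rewrite /= !mul0n !subn0; case: m => -[].
  by rewrite /mdecr /= !mulSn ![((_ == _) + _)%N]addnC !subnDA.
rewrite pderE !iter_mono_sum; apply: eq_bigr => s _.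
rewrite !iterE /mcoord /= !muln0 !muln1 !subn0 !natrM; congr (_ * _); ring.
Qed.

End PartialDerivatives.

(** * Jets and Taylor polynomials *)

Section Jets.
Variables (R : realType) (k : nat).
Local Notation P := 'rV[R]_3.
Implicit Type th : jet R k.

Lemma mexp_inj : injective (@mexp k).
Proof.
move=> [[[a b] c] H] [[[a' b'] c'] H'] [] ea eb ec.
apply: val_inj => /=; congr (_, _, _); exact: val_inj.
Qed.

Lemma mexp_le (s : midx k) : (mdeg (mexp s) <= k)%N.
Proof. exact: (valP s). Qed.

Lemma mexp_surj n : (mdeg n <= k)%N -> exists s : midx k, mexp s = n.
Proof.
case: n => -[a b] c le.
have H (d : nat) : (d <= a + b + c)%N -> (d < k.+1)%N.
  by move=> dle; rewrite ltnS (leq_trans dle).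
have Ha : (a < k.+1)%N by apply: H; rewrite -addnA leq_addr.
have Hb : (b < k.+1)%N by apply: H; rewrite addnAC leq_addl.
have Hc : (c < k.+1)%N by apply: H; rewrite leq_addl.
by exists (exist _ (Ordinal Ha, Ordinal Hb, Ordinal Hc) le).
Qed.

Lemma jcE th a s : jc th a (mexp s) = th.2 a (enum_rank s).
Proof.
rewrite /jc; case: pickP => [t /eqP/mexp_inj -> //|/(_ s)].
by rewrite eqxx.
Qed.

Lemma jc_gt th a n : (k < mdeg n)%N -> jc th a n = 0.
Proof.
move=> kn; rewrite /jc; case: pickP => // t /eqP tn.
by have := mexp_le t; rewrite tn leqNgt kn.
Qed.

Lemma jet_eqP (th th' : jet R k) : th.1 = th'.1 ->
  (forall a n, (mdeg n <= k)%N -> jc th a n = jc th' a n) -> th = th'.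
Proof.
case: th th' => [p M] [p' M'] /= -> H; congr pair; apply/matrixP => a c.
by have := H a (mexp (enum_val c)) (mexp_le _); rewrite !jcE /= !enum_valK.
Qed.

Lemma jc_jet_of (s : P -> P) p a n : (mdeg n <= k)%N ->
  jc (jet_of k s p) a n = pder n (fun q : P => s q 0 a : R) p.
Proof. by move=> /mexp_surj[t <-]; rewrite jcE mxE enum_rankK. Qed.

Lemma jc_jproj m (th : jet R m) a n : (mdeg n <= k)%N -> jc (jproj k th) a n = jc th a n.
Proof. by move=> /mexp_surj[t <-]; rewrite jcE mxE enum_rankK. Qed.

Lemma taylorE th a : (fun q => taylor th q 0 a) =
  (fun q => \sum_(s : midx k) (jc th a (mexp s)
      / (((mexp s).1.1)`! * ((mexp s).1.2)`! * ((mexp s).2)`!)%:R)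
      * mono th.1 (mexp s) q).
Proof.
by apply/funext => q; rewrite mxE; apply: eq_bigr => s _; rewrite /mono !mulrA.
Qed.

(** At the base point only the term with exponents [n] survives: the falling factorial vanishes if
    some exponent of the term is smaller, the monomial vanishes if some exponent is larger. For [n]
    of degree above [k] both sides are 0 by the convention in [jc]. *)
Lemma pder_taylor th a n : pder n (fun q => taylor th q 0 a) th.1 = jc th a n.
Proof.
rewrite taylorE pder_mono_sum.
have zero (s : midx k) : mexp s != n ->
    (((mexp s).1.1 ^_ n.1.1 * (mexp s).1.2 ^_ n.1.2 * (mexp s).2 ^_ n.2)%:R : R)
    * mono th.1 ((mexp s).1.1 - n.1.1, (mexp s).1.2 - n.1.2, (mexp s).2 - n.2)%N th.1
    = 0.
  move=> sn; rewrite monop !xpair_eqE; apply/eqP; rewrite -natrM pnatr_eq0.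
  apply: contraNT sn; rewrite -lt0n !muln_gt0 !ffact_gt0 lt0b !subn_eq0.
  case: (mexp s) n => -[a1 b1] c1 [[a2 b2] c2] /=.
  move=> /andP[/andP[/andP[le1 le2] le3] /andP[/andP[le4 le5] le6]].
  by rewrite !xpair_eqE !eqn_leq le1 le2 le3 le4 le5 le6.
case: (leqP (mdeg n) k) => [/mexp_surj[t tn]|kn].
  rewrite (bigD1 t) // big1 => [|s /andP[_ st]].
    rewrite [LHS]addr0 tn !ffactnn !subnn monop eqxx mulr1 divfK //.
  rewrite -mulrA zero ?mulr0 // -tn; apply: contra st => /eqP/mexp_inj ->.
  exact: eqxx.
rewrite jc_gt // big1 // => s _; rewrite -mulrA zero ?mulr0 //.
by apply: contraTneq kn => <-; rewrite -leqNgt mexp_le.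
Qed.

Lemma smooth_mono (p : P) n : smooth_on setT (mono p n).
Proof.
have sX i m : smooth_on setT (fun q : P => (q 0 i - p 0 i) ^+ m).
  apply: smoothX openT _; apply: smoothD openT _ _; first exact: smooth_coord openT.
  exact: smooth_cst openT.
by apply: smoothM openT _ _; first exact: smoothM openT _ _.
Qed.

Lemma smooth_taylor th a : smooth_on setT (fun q => taylor th q 0 a).
Proof.
rewrite taylorE; apply: smooth_sum openT _ => s.
apply: smoothM openT _ _; first exact: smooth_cst openT.
exact: smooth_mono.
Qed.

Lemma jet_of_taylor th : jet_of k (taylor th) th.1 = th.
Proof. by apply: jet_eqP => // a n le; rewrite jc_jet_of // pder_taylor. Qed.

End Jets.

(** * The prolonged action *)

Section Prolongation.
Variables (R : realType) (e : kundt_diffeo R).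
Local Notation P := 'rV[R]_3.
Local Notation D := (kcod e).
Local Notation psi := (kinv e).

Definition smooth_section (s : P -> P) := forall a, smooth_on setT (fun q => s q 0 a).

(* The affine differential operators of order <= N on sections, with values
   transported by the diffeomorphism.  The class contains the push-forward of
   metrics and is stable under derivation, which gives at once that the
   transformed section is smooth, that its k-jet depends only on the k-jet of
   the section, and that it does so differentiably. *)
Inductive jop (N : nat) : ((P -> P) -> P -> R) -> Prop :=
| JopC c of smooth_on D c : jop N (fun _ => c)
| JopT (c : P -> R) b m of smooth_on D c & (mdeg m <= N)%N :
    jop N (fun s q => c q * pder m (fun p => s p 0 b) (psi q))
| JopA T1 T2 of jop N T1 & jop N T2 : jop N (fun s q => T1 s q + T2 s q)
| JopE T1 T2 of jop N T1 &
    (forall s q, smooth_section s -> D q -> T1 s q = T2 s q) : jop N T2.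

Let oD : open D := @kcod_open R e.

Lemma kinv_diff q : D q -> differentiable psi q.
Proof. by move=> Dq; exact: (smooth_diff (@kinv_smooth _ e) Dq). Qed.

Lemma jop_sum N (I : Type) (r : seq I) T : (forall i : I, jop N (T i)) ->
  jop N (fun s q => \sum_(i <- r) T i s q).
Proof.
move=> jT; elim: r => [|i r IH].
  apply: (@JopE N (fun=> cst 0)); first by apply: JopC; exact: smooth_cst.
  by move=> s q _ _; rewrite big_nil.
apply: (@JopE N (fun s q => T i s q + \sum_(j <- r) T j s q)); first exact: JopA.
by move=> s q _ _; rewrite big_cons.
Qed.

Lemma jop_mul N (c : P -> R) T : smooth_on D c -> jop N T -> jop N (fun s q => c q * T s q).
Proof.
move=> sc; elim=> {T} [d sd|d b m sd mN|T1 T2 _ j1 _ j2|T1 T2 _ j1 eT].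
- by apply: JopC; exact: smoothM.
- apply: (@JopE N (fun s q => (c q * d q) * pder m (fun p => s p 0 b) (psi q))).
    by apply: JopT => //; exact: smoothM.
  by move=> s q _ _; rewrite mulrA.
- apply: (@JopE N (fun s q => c q * T1 s q + c q * T2 s q)); first exact: JopA.
  by move=> s q _ _; rewrite mulrDr.
- apply: (JopE j1) => s q ss Dq; by rewrite eT.
Qed.

Lemma jop_diff N T : jop N T ->
  forall s q, smooth_section s -> D q -> differentiable (T s) q.
Proof.
elim=> {T} [d sd|d b m sd mN|T1 T2 _ j1 _ j2|T1 T2 _ j1 eT] s q ss Dq.
- exact: (smooth_diff sd).
- apply: (@differentiableM _ _ d); first exact: (smooth_diff sd).
  apply: (@differentiable_comp _ _ _ _ psi); first exact: kinv_diff.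
  by apply: (smooth_diff (smooth_pder m (ss b))).
- by apply: (@differentiableD _ _ _ (T1 s) (T2 s)); [exact: j1|exact: j2].
- apply: (@near_eq_differentiable _ _ _ (T1 s)); last exact: j1.
  by apply: filterS (open_nbhs_nbhs (conj oD Dq)) => y Dy; exact: eT.
Qed.

Lemma mdeg_incr i m : mdeg (mincr i m) = (mdeg m).+1.
Proof.
by elim/case3: i; rewrite /mdeg /mincr /= ?addn0 addn1 ?addnS ?addSn.
Qed.

(** The product rule differentiates the coefficient, and the chain rule through [kinv e] turns
    [pder m] into a combination of the [pder (mincr j m)], which raises the order by one. *)
Lemma jop_derive N T v : jop N T -> jop N.+1 (fun s => 'D_v (T s)).
Proof.
elim=> {T} [d sd|d b m sd mN|T1 T2 jT1 j1 jT2 j2|T1 T2 _ j1 eT].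
- by apply: JopC; exact: smooth_derive.
- apply: (@JopE _ (fun s q => 'D_v d q * pder m (fun p => s p 0 b) (psi q) +
    \sum_(j < 3) (d q * 'D_v psi q 0 j)
      * pder (mincr j m) (fun p => s p 0 b) (psi q))).
    apply: JopA; first by apply: JopT; [exact: smooth_derive|exact: leqW].
    apply: jop_sum => j; apply: JopT; last by rewrite mdeg_incr.
    apply: smoothM => //; apply: smooth_entry => //.
    by apply: smooth_derive; exact: kinv_smooth.
  move=> s q ss Dq; apply/esym.
  have sb := smooth_pder m (ss b).
  have d1 : is_derive q v d ('D_v d q) by apply/is_derive_diff/(smooth_diff sd).
  have d2 : is_derive q v (fun q => pder m (fun p => s p 0 b) (psi q))
      (\sum_(j < 3) 'D_v psi q 0 j * pder (mincr j m) (fun p => s p 0 b) (psi q)).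
    apply: is_derive_eq.
      apply/is_derive_diff/(@differentiable_comp _ _ _ _ psi); first exact: kinv_diff.
      exact: (smooth_diff sb).
    rewrite derive_chain; [|exact: kinv_diff|exact: (smooth_diff sb)].
    by apply: eq_bigr => j _; rewrite (pd_pder _ _ openT) //; exact: ss.
  rewrite (derive_val (is_derive := is_derive_mul d1 d2)); congr (_ + _).
  by rewrite mulr_sumr; apply: eq_bigr => j _; rewrite mulrA.
- apply: (JopE (JopA j1 j2)) => s q ss Dq; apply/esym.
  apply: derive_val; apply: is_derive_add; apply: is_derive_diff.
    exact: (jop_diff jT1).
  exact: (jop_diff jT2).
- apply: (JopE j1) => s q ss Dq; apply: (eq_derive_on _ oD) => // x Dx.
  exact: eT.
Qed.

Lemma jop_iter N T n i : jop N T ->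
  jop (n + N) (fun s => iter n (fun f : P -> R => pd i f) (T s)).
Proof. by move=> jT; elim: n => //= n; exact: jop_derive. Qed.

Lemma jop_pder T n : jop 0 T -> jop (mdeg n) (fun s => pder n (T s)).
Proof.
move=> jT; rewrite /mdeg -addnA -[n.2]addn0.
by do 3!apply: jop_iter.
Qed.

Lemma jop_smooth N T s : jop N T -> smooth_section s -> smooth_on D (T s).
Proof.
move=> jT ss.
apply: (@smooth_coind _ _ _ D (fun f => exists M S, jop M S /\ f = S s)) => //.
- by move=> _ [M [S [jS ->]]] x Dx; exact: (jop_diff jS ss Dx).
- move=> _ v [M [S [jS ->]]]; exists ('D_v (S s)) => //.
  by exists M.+1, (fun s => 'D_v (S s)); split => //; exact: jop_derive.
- by exists N, T.
Qed.

Lemma jop_eq N T : jop N T -> forall s s' q, smooth_section s ->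
  smooth_section s' -> D q ->
  (forall b m, (mdeg m <= N)%N ->
     pder m (fun p => s p 0 b) (psi q) = pder m (fun p => s' p 0 b) (psi q)) ->
  T s q = T s' q.
Proof.
move=> jT s s' q ss ss' Dq H.
elim: jT => {T} [d sd //|d b m sd mN|T1 T2 _ j1 _ j2|T1 T2 _ j1 eT].
- by rewrite H.
- by rewrite j1 j2.
- by rewrite -!eT.
Qed.

(** The two difference quotients are the same function of the increment. This carries the derivative
    of [kC e] over to R^3, where its smoothness is given. *)
Lemma kmap_derive1C (p : P) : derive1 (kC e) (p 0 iu) = pd iu (fun p : P => kC e (p 0 iu)) p.
Proof.
rewrite /derive1 /derive; set d := (fun _ : R => _); set d' := (fun _ : R => _).
suff -> : d = d' by [].
by apply/funext => h; rewrite /d /d' /= !mxE eqxx mulr1.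
Qed.

Lemma kmapE p : kmap e p = row3 (kC e (p 0 iu)) (kA e (p 0 iu) (p 0 ix))
  (p 0 iv / pd iu (fun p : P => kC e (p 0 iu)) p + kB e (p 0 iu) (p 0 ix)).
Proof. by rewrite /kmap /kundt_map -kmap_derive1C. Qed.

Lemma kmap_diff p : kdom e p -> differentiable (kmap e) p.
Proof.
move=> ep; apply: differentiable_mx => i; rewrite ord1; elim/case3.
- under eq_fun do rewrite kmapE row3E; exact: (smooth_diff (@kC_smooth _ e)).
- under eq_fun do rewrite kmapE row3E; exact: (smooth_diff (@kA_smooth _ e)).
- under eq_fun do rewrite kmapE row3E.
  apply: (@differentiableD _ _ _ (fun p : P => p 0 iv / pd iu (fun p : P => kC e (p 0 iu)) p)).
    apply: (@differentiableM _ _ (fun p : P => p 0 iv)).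
      exact: differentiable_coord.
    apply: differentiableV.
      exact: (smooth_diff (smooth_derive _ (@kC_smooth _ e)) ep).
    by rewrite -kmap_derive1C; exact: kC_neq0.
  exact: (smooth_diff (@kB_smooth _ e)).
Qed.

Lemma differentiable_jc k (a : 'I_3) n (th : jet R k) :
  differentiable (fun th : jet R k => jc th a n) th.
Proof.
case: (leqP (mdeg n) k) => [/mexp_surj[s <-]|kn]; last first.
  by under eq_fun do rewrite jc_gt //; exact: differentiable_cst.
under eq_fun do rewrite jcE.
apply: differentiable_entry.
by apply: (@linear_differentiable _ _ _ snd) => x; exact: cvg_snd.
Qed.

Lemma differentiable_base k (th : jet R k) : differentiable (fun th : jet R k => th.1) th.
Proof. by apply: (@linear_differentiable _ _ _ fst) => x; exact: cvg_fst. Qed.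

(** By [pder_taylor] the derivatives of a Taylor polynomial at its base point are the jet
    coordinates, so near [th] each term is a smooth function of the base point times a jet
    coordinate. *)
Lemma jop_jet_diff k N T : jop N T -> (N <= k)%N -> forall th : jet R k,
  kdom e th.1 -> differentiable (fun th : jet R k => T (taylor th) (kmap e th.1)) th.
Proof.
move=> jT Nk th; elim: jT => {T} [d sd|d b m sd mN|T1 T2 _ j1 _ j2|T1 T2 _ j1 eT] eth.
- apply: (@differentiable_comp _ _ _ _ (fun th : jet R k => kmap e th.1) d).
    apply: (@differentiable_comp _ _ _ _ (fun th : jet R k => th.1)).
      exact: differentiable_base.
    exact: kmap_diff.
  by apply: (smooth_diff sd); exact: kmap_cod.
- apply: (@near_eq_differentiable _ _ _
    (fun th : jet R k => d (kmap e th.1) * jc th b m)).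
    have : nbhs th [set th : jet R k | kdom e th.1].
      apply: (differentiable_continuous (differentiable_base th)).
      exact: (open_nbhs_nbhs (conj (@kdom_open _ e) eth)).
    by apply: filterS => th' eth'; rewrite kmapK // pder_taylor.
  apply: (@differentiableM _ _ (fun th : jet R k => d (kmap e th.1))).
    apply: (@differentiable_comp _ _ _ _ (fun th : jet R k => kmap e th.1) d).
      apply: (@differentiable_comp _ _ _ _ (fun th : jet R k => th.1)).
        exact: differentiable_base.
      exact: kmap_diff.
    by apply: (smooth_diff sd); exact: kmap_cod.
  exact: differentiable_jc.
- by apply: (@differentiableD _ _ _ (fun th : jet R k => T1 (taylor th) (kmap e th.1)));
    [exact: j1|exact: j2].
- apply: (@near_eq_differentiable _ _ _
    (fun th : jet R k => T1 (taylor th) (kmap e th.1))); last exact: j1.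
  have : nbhs th [set th : jet R k | kdom e th.1].
    apply: (differentiable_continuous (differentiable_base th)).
    exact: (open_nbhs_nbhs (conj (@kdom_open _ e) eth)).
  apply: filterS => th' eth'; apply: eT; first by move=> a; exact: smooth_taylor.
  exact: kmap_cod.
Qed.

Lemma metric_entry (y : P) i j : metric y i j =
  2^-1 * ((i == iu)%:R * (j == iv)%:R + (i == iv)%:R * (j == iu)%:R)
  + ((i == iu)%:R * (j == iu)%:R * y 0 fH +
     (2^-1 * ((i == iu)%:R * (j == ix)%:R + (i == ix)%:R * (j == iu)%:R) * y 0 fW
    + (i == ix)%:R * (j == ix)%:R * y 0 fh)).
Proof.
by rewrite !mxE !big_ord1 !mxE /=; field.
Qed.

(** The transformed Gram matrix is linear in the metric, with coefficients quadratic in the Jacobian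
    of [kinv e]; no derivative of the section enters. *)
Lemma jop_act a : jop 0 (fun s q => act_section e s q 0 a).
Proof.
have jm i j : jop 0 (fun s q => metric (s (psi q)) i j).
  have jt c b : jop 0 (fun s q => c * s (psi q) 0 b).
    by apply: (@JopT 0 (fun=> c) b (0, 0, 0)%N) => //; exact: smooth_cst.
  apply: (@JopE 0 (fun s q => _ + (_ * s (psi q) 0 fH +
    (_ * s (psi q) 0 fW + _ * s (psi q) 0 fh)))); last first.
    by move=> s q _ _; rewrite metric_entry.
  apply: JopA; first by apply: (JopC _ (smooth_cst _ oD)).
  by apply: JopA => //; exact: JopA.
have JE y i j : D y -> ('J psi y) i j = 'D_(delta_mx 0 i : P) psi y 0 j.
  move=> Dy; rewrite deriveEjacobian; last exact: kinv_diff.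
  by rewrite -rowE [RHS]mxE.
have sJ i j : smooth_on D (fun q => ('J psi q) i j).
  (* The entry itself is adjoined to the smooth functions because it is a directional derivative of
     [kinv e] only on [kcod e]; every derivative of it then falls into the second class. *)
  apply: (@smooth_coind _ _ _ D (fun f => f = (fun q => ('J psi q) i j) \/
     smooth_on D f)) => //; last by left.
  - move=> f [->|sf] x Dx; last exact: (smooth_diff sf).
    apply: (@near_eq_differentiable _ _ _ (fun q => 'D_(delta_mx 0 i : P) psi q 0 j)).
      apply: filterS (open_nbhs_nbhs (conj oD Dx)) => y Dy.
      by rewrite JE.
    apply: differentiable_entry.
    exact: (smooth_diff (smooth_derive _ (@kinv_smooth _ e)) Dx).
  - move=> f v [->|sf]; last first.
      by exists ('D_v f) => //; right; exact: smooth_derive.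
    exists ('D_v (fun q => 'D_(delta_mx 0 i : P) psi q 0 j)).
      right; apply: smooth_derive; apply: smooth_entry => //.
      by apply: smooth_derive; exact: kinv_smooth.
    apply: eq_derive_on => // y Dy.
    by rewrite JE.
have jg i j : jop 0 (fun s q =>
    ('J psi q *m metric (s (psi q)) *m ('J psi q)^T) i j).
  apply: (@JopE 0 (fun s q => \sum_l ('J psi q) j l *
     \sum_m ('J psi q) i m * metric (s (psi q)) m l)).
    by apply: jop_sum => l; apply: jop_mul => //; apply: jop_sum => m; exact: jop_mul.
  move=> s q _ _; rewrite mxE; apply: eq_bigr => l _.
  by rewrite !mxE mulrC.
elim/case3: a.
- by apply: (JopE (jg iu iu)) => s q _ _; rewrite /act_section row3E.
- apply: (JopE (jop_mul (smooth_cst 2 oD) (jg iu ix))) => s q _ _.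
  by rewrite /act_section row3E.
- by apply: (JopE (jg ix ix)) => s q _ _; rewrite /act_section row3E.
Qed.

Lemma act_smooth s a : smooth_section s ->
  smooth_on D (fun q => act_section e s q 0 a).
Proof. exact: jop_smooth (jop_act a). Qed.

Lemma prolong_diff k (th : jet R k) : kdom e th.1 -> differentiable (@prolong R e k) th.
Proof.
move=> eth; apply: differentiable_pair.
  apply: (@differentiable_comp _ _ _ _ (fun th : jet R k => th.1)).
    exact: differentiable_base.
  exact: kmap_diff.
apply: differentiable_mx => a c.
under eq_fun do rewrite mxE.
exact: (jop_jet_diff (jop_pder _ (jop_act a)) (mexp_le _)).
Qed.

(** [prolong] is computed on the Taylor polynomial. That polynomial and [s] have the same k-jet at
    [p], and by [jop_eq] an operator of order at most [k] distinguishes nothing more. *)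
Lemma prolong_jet_of k s p : smooth_section s -> kdom e p ->
  prolong e (jet_of k s p) = jet_of k (act_section e s) (kmap e p).
Proof.
move=> ss ep; apply: jet_eqP => // a n nk; rewrite !jc_jet_of //.
apply: (jop_eq (jop_pder n (jop_act a))) => //; first exact: smooth_taylor.
  exact: kmap_cod.
move=> b m mn; rewrite kmapK //.
by rewrite (pder_taylor (jet_of k s p)) jc_jet_of //; exact: leq_trans nk.
Qed.

End Prolongation.

(** * Total derivatives *)

Section TotalDerivative.
Variable R : realType.
Local Notation P := 'rV[R]_3.

Lemma jproj_jet_of k m (s : P -> P) p : (k <= m)%N ->
  jproj k (jet_of m s p) = jet_of k s p.
Proof.
move=> km; apply: jet_eqP => // a n nk.
by rewrite jc_jproj // !jc_jet_of //; exact: leq_trans km.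
Qed.

Lemma jet_of_diff k (s : P -> P) U p : open U -> U p ->
  (forall a, smooth_on U (fun q => s q 0 a)) -> differentiable (jet_of k s) p.
Proof.
move=> oU Up ss; apply: differentiable_pair => //.
apply: differentiable_mx => a c; under eq_fun do rewrite mxE.
exact: (smooth_diff (smooth_pder _ (ss a)) Up).
Qed.

(** The tangent vector of the holonomic section; its components along [djet R a t] are the jet
    coordinates of order up to [k + 1] that appear in [totalD]. *)
Lemma derive_jet_of k (s : P -> P) U p i : open U -> U p ->
  (forall a, smooth_on U (fun q => s q 0 a)) ->
  'D_(delta_mx 0 i : P) (jet_of k s) p = dbase R k i +
    \sum_(a < 3) \sum_(t : midx k)
      pder (mincr i (mexp t)) (fun q => s q 0 a) p *: djet R a t.
Proof.
move=> oU Up ss.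
pose M q : 'M[R]_(3, #|midx k|) :=
  \matrix_(a, c) pder (mexp (enum_val (A := midx k) c)) (fun q => s q 0 a) q.
have dM : differentiable M p.
  apply: differentiable_mx => a c; under eq_fun do rewrite mxE.
  exact: (smooth_diff (smooth_pder _ (ss a)) Up).
have -> : 'D_(delta_mx 0 i : P) (jet_of k s) p =
    (delta_mx 0 i, 'D_(delta_mx 0 i : P) M p).
  rewrite deriveE; last exact: (jet_of_diff _ oU Up ss).
  rewrite (_ : jet_of k s = fun q => (id q, M q)) // diff_pair //= deriveE //.
  by rewrite diff_val.
have sum1 (I : Type) (r : seq I) (F : I -> jet R k) :
    (\sum_(j <- r) F j).1 = \sum_(j <- r) (F j).1.
  by elim/big_rec2 : _ => // j _ y _ <-.
have sum2 (I : Type) (r : seq I) (F : I -> jet R k) :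
    (\sum_(j <- r) F j).2 = \sum_(j <- r) (F j).2.
  by elim/big_rec2 : _ => // j _ y _ <-.
congr pair.
  rewrite sum1 big1 ?addr0 // => a _; rewrite sum1 big1 // => t _.
  by rewrite /= scaler0.
rewrite sum2 add0r; under eq_bigr do rewrite sum2.
rewrite (matrix_sum_delta ('D__ M p)); apply: eq_bigr => a _.
rewrite (reindex (@enum_rank (midx k))) /=; last first.
  exact/onW_bij/enum_rank_bij.
apply: eq_bigr => t _; congr (_ *: _).
rewrite -derive_entry // /M; under eq_fun do rewrite mxE enum_rankK.
exact: (pd_pder _ _ oU).
Qed.

(* On a holonomic section the total derivative is the ordinary one; symmetry of
   second derivatives identifies D_i (a_n) with a_{n + 1_i}. *)
Lemma totalD_jet_of k (G : jet R k -> R) (s : P -> P) U p i : open U -> U p ->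
  (forall a, smooth_on U (fun q => s q 0 a)) ->
  differentiable G (jet_of k s p) ->
  totalD i G (jet_of k.+1 s p) = pd i (fun q => G (jet_of k s q)) p.
Proof.
move=> oU Up ss dG; rewrite /totalD jproj_jet_of //.
have dj := jet_of_diff k oU Up ss.
rewrite (_ : (fun q => _) = G \o jet_of k s) //.
rewrite [RHS]deriveE; last exact: differentiable_comp.
rewrite diff_comp //= -(deriveE _ dj) (derive_jet_of _ _ oU Up ss) linearD.
rewrite deriveE //; congr (_ + _); rewrite linear_sum; apply: eq_bigr => a _.
rewrite linear_sum; apply: eq_bigr => t _; rewrite linearZ /= deriveE //.
by rewrite jc_jet_of // mdeg_incr ltnS mexp_le.
Qed.

Lemma totalD_prolong (e : kundt_diffeo R) k (F : jet R k -> R) (s : P -> P) p i :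
  smooth_section s -> kdom e p ->
  differentiable F (jet_of k (act_section e s) (kmap e p)) ->
  totalD i (F \o @prolong R e k) (jet_of k.+1 s p) =
  \sum_(j < 3) 'D_(delta_mx 0 i : P) (kmap e) p 0 j
    * totalD j F (jet_of k.+1 (act_section e s) (kmap e p)).
Proof.
move=> ss ep dF.
have cp := kmap_cod ep.
have oc : open (kcod e) by exact: kcod_open.
have sa a : smooth_on (kcod e) (fun q => act_section e s q 0 a).
  exact: act_smooth.
have pe := prolong_jet_of k ss ep.
rewrite (totalD_jet_of _ openT) //; last first.
  apply: differentiable_comp; first exact: prolong_diff.
  by rewrite pe.
(* [prolong_jet_of] holds throughout the open set [kdom e], so it may be used under the
   derivative. *)
rewrite (@eq_derive_on _ (kdom e) _
  (fun q => F (jet_of k (act_section e s) (kmap e q)))) //; last 2 first.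
- exact: kdom_open.
- by move=> q eq; rewrite /= prolong_jet_of.
rewrite (@derive_chain _ _ (kmap e) (fun q => F (jet_of k (act_section e s) q))).
- by apply: eq_bigr => j _; rewrite (totalD_jet_of _ oc).
- exact: kmap_diff.
- apply: (@differentiable_comp _ _ _ _ (jet_of k (act_section e s)) F) => //.
  exact: (jet_of_diff _ oc).
Qed.

(* The transformation law of the components of a vector field under [kmap e].
   The jet of a section representing a point of the equation may be taken
   polynomial, and then h_v = 0 and W_vv = 0 hold identically. *)
Definition coef_covariant (X : hfield R 2) := forall (e : kundt_diffeo R) s p,
  smooth_section s -> kdom e p ->
  pd iv (fun q => s q 0 fh) = cst 0 ->
  pd iv (pd iv (fun q => s q 0 fW)) = cst 0 ->
  0 < s p 0 fh -> hdom X (jet_of 2 s p) ->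
  [/\ 0 < act_section e s (kmap e p) 0 fh,
   hdom X (jet_of 2 (act_section e s) (kmap e p)) &
   forall j, \sum_(i < 3) hcoef X (jet_of 2 s p) 0 i
      * 'D_(delta_mx 0 i : P) (kmap e) p 0 j
    = hcoef X (jet_of 2 (act_section e s) (kmap e p)) 0 j].

(** The Taylor polynomial of [th] represents the jet, so [totalD_prolong] applies; exchanging the
    two sums over directions leaves exactly the transformation law of the coefficients. *)
Lemma coef_covariant_invariant X : coef_covariant X -> G_invariant X.
Proof.
move=> cX e k m F th m2 km sF eth kth.
pose s := taylor th; have ss : smooth_section s by move=> a; exact: smooth_taylor.
have pE : prolong e th = jet_of m (act_section e s) (kmap e th.1) by [].
have jE r : (r <= m)%N -> jproj r th = jet_of r s th.1.
  by move=> rm; rewrite -{1}(jet_of_taylor th) jproj_jet_of.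
rewrite pE jproj_jet_of // jE // => Xth.
have [Jth hv Wvv _] := kth.
have sh : 0 < s th.1 0 fh.
  by have := Jth; rewrite /Jpi /= -(pder_taylor th).
(* Terms free of v are killed by the derivative, and terms containing v have a coefficient that
   vanishes on the equation. The same argument with degree at least 2 in v gives [Wvv0]. *)
have hv0 : pd iv (fun q => s q 0 fh) = cst 0.
  rewrite /s taylorE pd_mono_sum; apply/funext => q; rewrite big1 // => t _.
  case: (mexp t) (mexp_le t) => -[a b] [|c] le.
    by rewrite /mcoord /= mulr0 mul0r.
  by rewrite hv // !mul0r.
have Wvv0 : pd iv (pd iv (fun q => s q 0 fW)) = cst 0.
  rewrite /s taylorE !pd_mono_sum; apply/funext => q; rewrite big1 // => t _.
  case: (mexp t) (mexp_le t) => -[a b] [|[|c]] le.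
  - by rewrite /mcoord /= mulr0 !mul0r.
  - by rewrite /mcoord /mdecr /= !mulr0 mul0r.
  - by rewrite Wvv // !mul0r.
have [ah aX lawX] := cX e s th.1 ss eth hv0 Wvv0 sh Xth.
split=> //; rewrite /happly !jproj_jet_of // !jE //.
have dF : differentiable F (jet_of k (act_section e s) (kmap e th.1)).
  by apply: (smooth_diff sF); rewrite /Jpi /= jc_jet_of.
under eq_bigr => i _ do rewrite totalD_prolong // mulr_sumr.
rewrite exchange_big; apply: eq_bigr => j _ /=.
by rewrite -lawX mulr_suml; apply: eq_bigr => i _; rewrite mulrA.
Qed.

End TotalDerivative.

(** * The transformed metric and its 2-jet *)

Section PushForward.
Variable R : realType.
Implicit Types c a au b bx : R.

Lemma row3_sum a b c (F : 'I_3 -> R) :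
  \sum_(j < 3) row3 a b c 0 j * F j = a * F iu + b * F ix + c * F iv.
Proof. by rewrite sum3 !row3E. Qed.

Lemma row3_fH a b c : row3 a b c 0 fH = a. Proof. by rewrite mxE. Qed.
Lemma row3_fW a b c : row3 a b c 0 fW = b. Proof. by rewrite mxE. Qed.
Lemma row3_fh a b c : row3 a b c 0 fh = c. Proof. by rewrite mxE. Qed.

(* The inverse of the Jacobian matrix
   [[c, au, b], [0, a, bx], [0, 0, 1 / c]] of a transformation. *)
Definition inv_jacobian c a au b bx : 'M[R]_3 := \matrix_i nth 0
  [:: row3 c^-1 (- au / (c * a)) (- b + au * bx / a);
      row3 0 a^-1 (- (bx * c / a)); row3 0 0 c] i.

Lemma inv_jacobian_row c a au b bx :
  [/\ inv_jacobian c a au b bx iu = row3 c^-1 (- au / (c * a)) (- b + au * bx / a) 0,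
      inv_jacobian c a au b bx ix = row3 0 a^-1 (- (bx * c / a)) 0 &
      inv_jacobian c a au b bx iv = row3 0 0 c 0].
Proof. by split; apply/funext => j; rewrite !mxE. Qed.

Lemma inv_jacobianE c a au b bx i : c != 0 -> a != 0 ->
  let M := inv_jacobian c a au b bx in
  M i iu *: row3 c au b + M i ix *: row3 0 a bx + M i iv *: row3 0 0 c^-1
  = delta_mx 0 i.
Proof.
move=> c0 a0 /=; have [Ru Rx Rv] := inv_jacobian_row c a au b bx.
have E (x y z : R) : x *: row3 c au b + y *: row3 0 a bx + z *: row3 0 0 c^-1
    = row3 (x * c) (x * au + y * a) (x * b + y * bx + z / c).
  by apply/rowP; elim/case3; rewrite !mxE /=; ring.
have delta3 k : (delta_mx 0 k : 'rV[R]_3) = row3 (k == iu)%:R (k == ix)%:R (k == iv)%:R.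
  by apply/rowP; elim/case3; rewrite !mxE eqxx eq_sym.
rewrite E delta3; elim/case3: i => /=; rewrite ?Ru ?Rx ?Rv !row3E; congr row3.
all: by field; rewrite ?c0 ?a0.
Qed.

(** The formulas for H', W' and h'. They are written with opposites and inverses instead of
    differences and quotients, so that their derivatives can be assembled factor by factor. *)
Lemma push_metric c a au b bx (y : 'rV[R]_3) : c != 0 -> a != 0 ->
  let M := inv_jacobian c a au b bx in
  metric_coords (M *m metric y *m M^T) =
  row3 (y 0 fH * (c ^+ 2)^-1 + - (y 0 fW * au * (c ^+ 2 * a)^-1)
         + (- b + au * bx * a^-1) * c^-1 + y 0 fh * au ^+ 2 * (c ^+ 2 * a ^+ 2)^-1)
       (y 0 fW * (c * a)^-1 + - (bx * a^-1) + - (2 * y 0 fh * au * (c * a ^+ 2)^-1))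
       (y 0 fh * (a ^+ 2)^-1).
Proof.
move=> c0 a0 M; have [Ru Rx Rv] := inv_jacobian_row c a au b bx.
have E i j : (M *m metric y *m M^T) i j =
    (\sum_(m < 3) M i m * metric y m iu) * M j iu
    + (\sum_(m < 3) M i m * metric y m ix) * M j ix
    + (\sum_(m < 3) M i m * metric y m iv) * M j iv.
  by rewrite mxE [LHS]sum3; congr (_ + _ + _); rewrite mxE [M^T _ _]mxE.
have m3 i : [/\ \sum_(m < 3) M i m * metric y m iu =
      M i iu * y 0 fH + M i ix * (y 0 fW / 2) + M i iv / 2,
    \sum_(m < 3) M i m * metric y m ix = M i iu * (y 0 fW / 2) + M i ix * y 0 fh &
    \sum_(m < 3) M i m * metric y m iv = M i iu / 2].
  by rewrite !sum3 !metric_entry /=; split; field.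
rewrite /metric_coords !E.
have [-> -> ->] := m3 iu; have [-> -> ->] := m3 ix.
rewrite /M Ru Rx !row3E; move: (y 0 fH) (y 0 fW) (y 0 fh) => H W h.
by congr row3; field; rewrite ?c0 ?a0.
Qed.

End PushForward.

(** * Derivatives of the transformation and of the transformed metric *)

Section TransformedMetric.
Variables (R : realType) (e : kundt_diffeo R).
Local Notation P := 'rV[R]_3.
Local Notation D := (kdom e).

Let oD : open D := @kdom_open R e.

(** Independence of a coordinate is encoded as invariance under translation, which difference
    quotients, and hence all directional derivatives, inherit. *)
Definition indep (v : P) (f : P -> R) := forall p h, f (h *: v + p) = f p.

Lemma indep_derive0 v f p : indep v f -> 'D_v f p = 0.
Proof.
move=> vf; rewrite -(derive_cst (f p) p v) /derive.
set d := (fun _ : R => _); set d' := (fun _ : R => _); suff -> : d = d' by [].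
by apply/funext => h; rewrite /d /d' /= vf.
Qed.

Lemma indep_derive v w f : indep v f -> indep v ('D_w f).
Proof.
move=> vf p h; rewrite /derive.
set d := (fun _ : R => _); set d' := (fun _ : R => _); suff -> : d = d' by [].
apply/funext => k; rewrite /d /d' /= vf.
by rewrite addrCA vf.
Qed.

(** The data of the transformation are lifted to R^3, because their smoothness is given in this form
    and all their derivatives then become [pd]. *)
Definition Cf (p : P) := kC e (p 0 iu).
Definition Af (p : P) := kA e (p 0 iu) (p 0 ix).
Definition Bf (p : P) := kB e (p 0 iu) (p 0 ix).

Local Notation C1 := (pd iu Cf).
Local Notation C2 := (pd iu C1).
Local Notation Au := (pd iu Af).
Local Notation Ax := (pd ix Af).

(* The u-derivative of the v-component v / C' + B of the diffeomorphism. *)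
Definition bf (p : P) := pd iu Bf p - p 0 iv * C2 p / C1 p ^+ 2.

Lemma Cf_indep_x : indep (delta_mx 0 ix) Cf.
Proof. by move=> p h; rewrite /Cf !mxE mulr0 add0r. Qed.
Lemma Cf_indep_v : indep (delta_mx 0 iv) Cf.
Proof. by move=> p h; rewrite /Cf !mxE mulr0 add0r. Qed.
Lemma Af_indep_v : indep (delta_mx 0 iv) Af.
Proof. by move=> p h; rewrite /Af !mxE !mulr0 !add0r. Qed.
Lemma Bf_indep_v : indep (delta_mx 0 iv) Bf.
Proof. by move=> p h; rewrite /Bf !mxE !mulr0 !add0r. Qed.

Lemma Cf_smooth : smooth_on D Cf. Proof. exact: kC_smooth. Qed.
Lemma Af_smooth : smooth_on D Af. Proof. exact: kA_smooth. Qed.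
Lemma Bf_smooth : smooth_on D Bf. Proof. exact: kB_smooth. Qed.

Lemma C1_neq0 p : D p -> C1 p != 0.
Proof. by move=> Dp; rewrite /Cf -kmap_derive1C; exact: kC_neq0. Qed.

Lemma Ax_neq0 p : D p -> Ax p != 0.
Proof.
move=> Dp; suff <- : derive1 (kA e (p 0 iu)) (p 0 ix) = Ax p by exact: kA_neq0.
rewrite /derive1 /derive; set d := (fun _ : R => _); set d' := (fun _ : R => _).
suff -> : d = d' by [].
by apply/funext => h; rewrite /d /d' /Af /= !mxE !eqxx /= mulr0 add0r mulr1.
Qed.

Lemma is_derive_pd (f : P -> R) p v : smooth_on D f -> D p ->
  is_derive p v f ('D_v f p).
Proof. by move=> sf Dp; apply/is_derive_diff/(smooth_diff sf). Qed.

Lemma is_derive_indep (f : P -> R) p v : smooth_on D f -> D p -> indep v f ->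
  is_derive p v f 0.
Proof.
by move=> sf Dp vf; apply: is_derive_eq (is_derive_pd v sf Dp) _; rewrite indep_derive0.
Qed.

Lemma kmap_fE p : (kmap e p 0 iu = Cf p) * (kmap e p 0 ix = Af p) *
  (kmap e p 0 iv = p 0 iv * (C1 p)^-1 + Bf p).
Proof. by rewrite kmapE !row3E. Qed.

Lemma derive_kmapE p i j : D p ->
  'D_(delta_mx 0 i : P) (kmap e) p 0 j = pd i (fun q => kmap e q 0 j) p.
Proof. by move=> Dp; rewrite -derive_entry //; exact: kmap_diff. Qed.

Lemma derive_kmap p : D p ->
  [/\ 'D_(delta_mx 0 iu : P) (kmap e) p = row3 (C1 p) (Au p) (bf p),
      'D_(delta_mx 0 ix : P) (kmap e) p = row3 0 (Ax p) (pd ix Bf p) &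
      'D_(delta_mx 0 iv : P) (kmap e) p = row3 0 0 (C1 p)^-1].
Proof.
move=> Dp; have c0 := C1_neq0 Dp.
have E i (a b c : R) : is_derive p (delta_mx 0 i : P) Cf a ->
    is_derive p (delta_mx 0 i : P) Af b ->
    is_derive p (delta_mx 0 i : P) (fun p => p 0 iv * (C1 p)^-1 + Bf p) c ->
    'D_(delta_mx 0 i : P) (kmap e) p = row3 a b c.
  move=> da db dc; apply/rowP; elim/case3; rewrite derive_kmapE // row3E.
  - by under eq_fun do rewrite kmap_fE; apply: derive_val.
  - by under eq_fun do rewrite kmap_fE; apply: derive_val.
  - by under eq_fun do rewrite kmap_fE; apply: derive_val.
have sC1 := smooth_derive (delta_mx 0 iu : P) Cf_smooth.
have d3 i (c1 b : R) : is_derive p (delta_mx 0 i : P) C1 c1 ->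
   is_derive p (delta_mx 0 i : P) Bf b ->
   is_derive p (delta_mx 0 i : P) (fun p => p 0 iv * (C1 p)^-1 + Bf p)
    ((i == iv)%:R * (C1 p)^-1 + p 0 iv * (- c1 / C1 p ^+ 2) + b).
  move=> dc db; have := is_derive_coord p (delta_mx 0 i) iv.
  rewrite mxE eqxx /= eq_sym => dv.
  exact: (is_derive_add (is_derive_mul dv (is_derive_inv dc c0)) db).
split; apply: E.
- exact: is_derive_pd Cf_smooth Dp.
- exact: is_derive_pd Af_smooth Dp.
- apply: is_derive_eq (d3 _ _ _ (is_derive_pd _ sC1 Dp) (is_derive_pd _ Bf_smooth Dp)) _.
  by rewrite /bf /=; field.
- exact: is_derive_indep Cf_smooth Dp Cf_indep_x.
- exact: is_derive_pd Af_smooth Dp.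
- have dc := is_derive_indep sC1 Dp (indep_derive _ Cf_indep_x).
  apply: is_derive_eq (d3 _ _ _ dc (is_derive_pd _ Bf_smooth Dp)) _.
  by rewrite /=; field.
- exact: is_derive_indep Cf_smooth Dp Cf_indep_v.
- exact: is_derive_indep Af_smooth Dp Af_indep_v.
- have dc := is_derive_indep sC1 Dp (indep_derive _ Cf_indep_v).
  have db := is_derive_indep Bf_smooth Dp Bf_indep_v.
  by apply: is_derive_eq (d3 _ _ _ dc db) _; rewrite /=; field.
Qed.

Lemma derive_comp_kmap (f : P -> R) p : D p -> smooth_on (kcod e) f ->
  [/\ pd iu (fun q => f (kmap e q)) p = C1 p * pd iu f (kmap e p)
        + Au p * pd ix f (kmap e p) + bf p * pd iv f (kmap e p),
      pd ix (fun q => f (kmap e q)) p = Ax p * pd ix f (kmap e p)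
        + pd ix Bf p * pd iv f (kmap e p) &
      pd iv (fun q => f (kmap e q)) p = pd iv f (kmap e p) / C1 p].
Proof.
move=> Dp sf; have [du dx dv] := derive_kmap Dp.
have H i : pd i (fun q => f (kmap e q)) p =
    \sum_(j < 3) 'D_(delta_mx 0 i : P) (kmap e) p 0 j * pd j f (kmap e p).
  apply: derive_chain; first exact: kmap_diff.
  by apply: (smooth_diff sf); exact: kmap_cod.
rewrite !H du dx dv !row3_sum.
move: (C1 p) (Au p) (Ax p) (pd ix Bf p) (bf p) (pd iu f _) (pd ix f _) (pd iv f _).
by move=> *; split; ring.
Qed.

Definition jinv (p : P) := inv_jacobian (C1 p) (Ax p) (Au p) (bf p) (pd ix Bf p).

Lemma jinvE p i : D p ->
  \sum_(j < 3) jinv p i j *: 'D_(delta_mx 0 j : P) (kmap e) p = delta_mx 0 i.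
Proof.
move=> Dp; have c0 := C1_neq0 Dp; have a0 := Ax_neq0 Dp.
rewrite sum3; have [-> -> ->] := derive_kmap Dp.
exact: inv_jacobianE.
Qed.

(** Differentiating the identity [kinv e (kmap e q) = q] shows that the Jacobian of [kinv e] sends
    the rows of that of [kmap e] to basis vectors; [jinvE] expands the basis vectors in those
    rows. *)
Lemma jacobian_kinv p : D p -> jacobian (kinv e) (kmap e p) = jinv p.
Proof.
move=> Dp; have dk := kmap_diff Dp; have di := kinv_diff (kmap_cod Dp).
have H i : 'D_(delta_mx 0 i : P) (kmap e) p *m jacobian (kinv e) (kmap e p)
    = delta_mx 0 i.
  rewrite -deriveEjacobian // [LHS]deriveE // [X in 'd _ _ X]deriveE //.
  rewrite -[LHS]/(('d (kinv e) (kmap e p) \o 'd (kmap e) p) _) -diff_comp //.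
  rewrite -deriveE; last exact: differentiable_comp.
  transitivity ('D_(delta_mx 0 i : P) (@id P) p); last exact: derive_id.
  apply: near_eq_derive.
  by apply: filterS (open_nbhs_nbhs (conj oD Dp)) => q Dq /=; exact: kmapK.
apply/row_matrixP => i; rewrite rowE -(jinvE i Dp) mulmx_suml.
rewrite [RHS]row_sum_delta; apply: eq_bigr => j _.
by rewrite -scalemxAl H [in RHS]mxE.
Qed.

Section TransformedJet.
Variable s : P -> P.
Hypothesis ss : smooth_section s.

Lemma act_kmap p : D p ->
  [/\ act_section e s (kmap e p) 0 fH = s p 0 fH * (C1 p ^+ 2)^-1
         + - (s p 0 fW * Au p * (C1 p ^+ 2 * Ax p)^-1)
         + (- bf p + Au p * pd ix Bf p * (Ax p)^-1) * (C1 p)^-1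
         + s p 0 fh * Au p ^+ 2 * (C1 p ^+ 2 * Ax p ^+ 2)^-1,
      act_section e s (kmap e p) 0 fW = s p 0 fW * (C1 p * Ax p)^-1
         + - (pd ix Bf p * (Ax p)^-1)
         + - (2 * s p 0 fh * Au p * (C1 p * Ax p ^+ 2)^-1) &
      act_section e s (kmap e p) 0 fh = s p 0 fh * (Ax p ^+ 2)^-1].
Proof.
move=> Dp; have c0 := C1_neq0 Dp; have a0 := Ax_neq0 Dp.
rewrite /act_section jacobian_kinv // kmapK // push_metric //.
by rewrite row3_fH row3_fW row3_fh.
Qed.

Lemma is_derive_section (f : P -> R) p v : smooth_on setT f -> is_derive p v f ('D_v f p).
Proof. by move=> sf; apply/is_derive_diff/(smooth_diff sf). Qed.

Section Transport.
Variables (f G : P -> R).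
Hypothesis sf : smooth_on (kcod e) f.
Hypothesis fG : forall p, D p -> f (kmap e p) = G p.

(** The system in [derive_comp_kmap] is triangular and is solved first for the v-derivative, then
    for x, then for u. The u-derivative is wanted only for h and W_v, whose v-derivative is 0. *)
Lemma transport_v p gv : D p -> is_derive p (delta_mx 0 iv : P) G gv ->
  pd iv f (kmap e p) = gv * C1 p.
Proof.
move=> Dp [_ <-]; have [_ _] := derive_comp_kmap Dp sf.
rewrite (eq_derive_on _ oD fG) // => ->.
by rewrite divfK //; exact: C1_neq0.
Qed.

Lemma transport_x p gx gv : D p -> is_derive p (delta_mx 0 ix : P) G gx ->
  is_derive p (delta_mx 0 iv : P) G gv ->
  pd ix f (kmap e p) = (gx - pd ix Bf p * (gv * C1 p)) / Ax p.
Proof.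
move=> Dp [_ <-] dv; have [_ + _] := derive_comp_kmap Dp sf.
rewrite (eq_derive_on _ oD fG) // (transport_v Dp dv) => ->.
by rewrite addrK mulrC mulKf //; exact: Ax_neq0.
Qed.

Lemma transport_u p gu : D p -> is_derive p (delta_mx 0 iu : P) G gu ->
  is_derive p (delta_mx 0 iv : P) G 0 ->
  pd iu f (kmap e p) = (gu - Au p * pd ix f (kmap e p)) / C1 p.
Proof.
move=> Dp [_ <-] dv; have [+ _ _] := derive_comp_kmap Dp sf.
rewrite (eq_derive_on _ oD fG) // (transport_v Dp dv) mul0r mulr0 addr0 => ->.
by rewrite addrK mulrC mulKf //; exact: C1_neq0.
Qed.

End Transport.

Hypothesis hv0 : pd iv (fun q => s q 0 fh) = cst 0.
Hypothesis Wvv0 : pd iv (pd iv (fun q => s q 0 fW)) = cst 0.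

(* [field] is slow on terms mentioning [derive], hence their abstraction. *)
Ltac field_pd c0 a0 := move: c0 a0;
  repeat match goal with |- context [derive ?f ?x ?v] =>
    let r := fresh in move: (derive f x v) => r end;
  let h1 := fresh in let h2 := fresh in move=> h1 h2; field; rewrite ?h1 ?h2.

Section AtPoint.
Variable p : P.
Hypothesis Dp : D p.
Let c0 := C1_neq0 Dp.
Let a0 := Ax_neq0 Dp.
Let sH : smooth_on setT (fun q => s q 0 fH) := ss fH.
Let sW : smooth_on setT (fun q => s q 0 fW) := ss fW.
Let sh : smooth_on setT (fun q => s q 0 fh) := ss fh.
Let sC1 : smooth_on D C1 := smooth_derive _ Cf_smooth.
Let sC2 : smooth_on D C2 := smooth_derive _ sC1.
Let sAu : smooth_on D Au := smooth_derive _ Af_smooth.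
Let sAx : smooth_on D Ax := smooth_derive _ Af_smooth.
Let sBx : smooth_on D (pd ix Bf) := smooth_derive _ Bf_smooth.
Let sBu : smooth_on D (pd iu Bf) := smooth_derive _ Bf_smooth.

(** Among the coefficients in [act_kmap] that come from the transformation only [bf] depends on v,
    and it is affine in v. *)
Lemma derive_v_coefs :
  [/\ [/\ is_derive p (delta_mx 0 iv : P) C1 0, is_derive p (delta_mx 0 iv : P) C2 0,
     is_derive p (delta_mx 0 iv : P) Au 0 & is_derive p (delta_mx 0 iv : P) Ax 0],
    is_derive p (delta_mx 0 iv : P) (pd ix Bf) 0,
    is_derive p (delta_mx 0 iv : P) bf (- C2 p / C1 p ^+ 2) &
    is_derive p (delta_mx 0 iv : P) (fun q => s q 0 fh) 0].
Proof.
have d1 := is_derive_indep sC1 Dp (indep_derive _ Cf_indep_v).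
have d2 := is_derive_indep sC2 Dp (indep_derive _ (indep_derive _ Cf_indep_v)).
have d3 := is_derive_indep sBu Dp (indep_derive _ Bf_indep_v).
split.
- split; [exact: d1|exact: d2| |].
    exact: is_derive_indep sAu Dp (indep_derive _ Af_indep_v).
  exact: is_derive_indep sAx Dp (indep_derive _ Af_indep_v).
- exact: is_derive_indep sBx Dp (indep_derive _ Bf_indep_v).
- have dv := is_derive_coord p (delta_mx 0 iv) iv; rewrite mxE !eqxx /= in dv.
  have dd := is_derive_add d3 (is_derive_opp (is_derive_mul (is_derive_mul dv d2)
    (is_derive_inv (is_derive_sqr d1) (expf_neq0 2 c0)))).
  by apply: is_derive_eq dd _; field.
- have := is_derive_section p (delta_mx 0 iv) sh.
  by rewrite -[X in is_derive _ _ _ X]/(pd iv (fun q => s q 0 fh) p) hv0.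
Qed.

Lemma act_Wv : pd iv (fun q => act_section e s q 0 fW) (kmap e p) =
  pd iv (fun q => s q 0 fW) p * (Ax p)^-1.
Proof.
have [[d1 d2 d3 d4] d5 d6 d7] := derive_v_coefs.
have dW := is_derive_section p (delta_mx 0 iv) sW.
have dCA := is_derive_inv (is_derive_mul d1 d4) (mulf_neq0 c0 a0).
have dCA2 := is_derive_inv (is_derive_mul d1 (is_derive_sqr d4))
  (mulf_neq0 c0 (expf_neq0 2 a0)).
have dA := is_derive_inv d4 a0.
have fG q (Dq : D q) : _ := let: And3 _ E _ := act_kmap Dq in E.
(* The derivative of the right-hand side of [fG] is assembled by instance
   resolution from the derivatives of its factors above. *)
rewrite (transport_v (act_smooth _ ss) fG Dp); rewrite /GRing.scale /=.
by field_pd c0 a0.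
Qed.

(** The last term comes from [- bf / C'] in H', through the v-dependence of [bf]. *)
Lemma act_Hv : pd iv (fun q => act_section e s q 0 fH) (kmap e p) =
  pd iv (fun q => s q 0 fH) p * (C1 p)^-1
  + - (pd iv (fun q => s q 0 fW) p * Au p * (C1 p * Ax p)^-1)
  + C2 p * (C1 p ^+ 2)^-1.
Proof.
have [[d1 d2 d3 d4] d5 d6 d7] := derive_v_coefs.
have dW := is_derive_section p (delta_mx 0 iv) sW.
have dH := is_derive_section p (delta_mx 0 iv) sH.
have dC2 := is_derive_inv (is_derive_sqr d1) (expf_neq0 2 c0).
have dC2A := is_derive_inv (is_derive_mul (is_derive_sqr d1) d4)
  (mulf_neq0 (expf_neq0 2 c0) a0).
have dC2A2 := is_derive_inv (is_derive_mul (is_derive_sqr d1) (is_derive_sqr d4))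
  (mulf_neq0 (expf_neq0 2 c0) (expf_neq0 2 a0)).
have dA := is_derive_inv d4 a0.
have dC := is_derive_inv d1 c0.
have fG q (Dq : D q) : _ := let: And3 E _ _ := act_kmap Dq in E.
rewrite (transport_v (act_smooth _ ss) fG Dp); rewrite /GRing.scale /=.
by field_pd c0 a0.
Qed.

End AtPoint.

Section SecondOrder.
Variable p : P.
Hypothesis Dp : D p.
Let c0 := C1_neq0 Dp.
Let a0 := Ax_neq0 Dp.
Let sAu : smooth_on D Au := smooth_derive _ Af_smooth.
Let sAx : smooth_on D Ax := smooth_derive _ Af_smooth.
Let sC1 : smooth_on D C1 := smooth_derive _ Cf_smooth.
Let sC2 : smooth_on D C2 := smooth_derive _ sC1.

Let dAxi i : is_derive p (delta_mx 0 i : P) Ax (pd i Ax p) := is_derive_pd _ sAx Dp.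

Let dWv0 : is_derive p (delta_mx 0 iv : P) (pd iv (fun q => s q 0 fW)) 0.
Proof.
apply: is_derive_eq (is_derive_section _ _ (smooth_derive _ (ss fW))) _.
exact: (congr1 (@^~ p) Wvv0).
Qed.

Lemma act_h_derive :
  pd ix (fun q => act_section e s q 0 fh) (kmap e p) =
    (pd ix (fun q => s q 0 fh) p / Ax p ^+ 2
     - 2 * s p 0 fh * pd ix Ax p / Ax p ^+ 3) / Ax p /\
  pd iu (fun q => act_section e s q 0 fh) (kmap e p) =
    (pd iu (fun q => s q 0 fh) p / Ax p ^+ 2
     - 2 * s p 0 fh * pd iu Ax p / Ax p ^+ 3
     - Au p * pd ix (fun q => act_section e s q 0 fh) (kmap e p)) / C1 p.
Proof.
have fG q (Dq : D q) : _ := let: And3 _ _ E := act_kmap Dq in E.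
have dG i := is_derive_mul (is_derive_section p (delta_mx 0 i) (ss fh))
  (is_derive_inv (is_derive_sqr (dAxi i)) (expf_neq0 2 a0)).
have [[_ _ _ d4] _ _ d7] := derive_v_coefs Dp.
have dv : is_derive p (delta_mx 0 iv : P)
    (fun q => s q 0 fh * (Ax q ^+ 2)^-1) 0.
  apply: is_derive_eq (is_derive_mul d7
    (is_derive_inv (is_derive_sqr d4) (expf_neq0 2 a0))) _.
  by rewrite mul0r mulr0 oppr0 mul0r mulr0 addr0.
split.
  rewrite (transport_x (act_smooth _ ss) fG Dp (dG ix) dv).
  by field_pd c0 a0.
rewrite (transport_u (act_smooth _ ss) fG Dp (dG iu) dv).
by field_pd c0 a0.
Qed.

(** [act_Wv] holds on all of [kdom e] and can therefore be transported in turn; its right-hand side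
    has zero v-derivative because W_vv = 0. *)
Lemma act_Wv_derive :
  pd ix (pd iv (fun q => act_section e s q 0 fW)) (kmap e p) =
    (pd ix (pd iv (fun q => s q 0 fW)) p / Ax p
     - pd iv (fun q => s q 0 fW) p * pd ix Ax p / Ax p ^+ 2) / Ax p /\
  pd iu (pd iv (fun q => act_section e s q 0 fW)) (kmap e p) =
    (pd iu (pd iv (fun q => s q 0 fW)) p / Ax p
     - pd iv (fun q => s q 0 fW) p * pd iu Ax p / Ax p ^+ 2
     - Au p * pd ix (pd iv (fun q => act_section e s q 0 fW)) (kmap e p)) / C1 p.
Proof.
have [[_ _ _ d4] _ _ _] := derive_v_coefs Dp.
have sW' := smooth_derive (delta_mx 0 iv : P) (act_smooth (e := e) fW ss).
have dG i := is_derive_mul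
  (is_derive_section p (delta_mx 0 i) (smooth_derive (delta_mx 0 iv : P) (ss fW)))
  (is_derive_inv (dAxi i) a0).
have dv : is_derive p (delta_mx 0 iv : P)
    (fun q => pd iv (fun q => s q 0 fW) q * (Ax q)^-1) 0.
  apply: is_derive_eq (is_derive_mul dWv0 (is_derive_inv d4 a0)) _.
  by rewrite mul0r oppr0 mul0r mulr0 addr0.
split.
  rewrite (transport_x sW' act_Wv Dp (dG ix) dv).
  by field_pd c0 a0.
rewrite (transport_u sW' act_Wv Dp (dG iu) dv).
by field_pd c0 a0.
Qed.

Lemma act_Hv_derive :
  pd iv (pd iv (fun q => act_section e s q 0 fH)) (kmap e p) =
    pd iv (pd iv (fun q => s q 0 fH)) p /\
  pd ix (pd iv (fun q => act_section e s q 0 fH)) (kmap e p) =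
    (pd ix (pd iv (fun q => s q 0 fH)) p / C1 p
     - pd ix (pd iv (fun q => s q 0 fW)) p * Au p / (C1 p * Ax p)
     - pd iv (fun q => s q 0 fW) p * (pd iu Ax p * Ax p - Au p * pd ix Ax p)
       / (C1 p * Ax p ^+ 2)
     - pd ix Bf p * pd iv (pd iv (fun q => s q 0 fH)) p) / Ax p.
Proof.
have sH' := smooth_derive (delta_mx 0 iv : P) (act_smooth (e := e) fH ss).
have dH i := is_derive_section p (delta_mx 0 i)
  (smooth_derive (delta_mx 0 iv : P) (ss fH)).
have dW i := is_derive_section p (delta_mx 0 i)
  (smooth_derive (delta_mx 0 iv : P) (ss fW)).
(* The derivative of the right-hand side of [act_Hv] in direction [i], given those of its
   coefficients; it serves for both v and x. *)
have dG i c1 c2 a au w : is_derive p (delta_mx 0 i : P) C1 c1 ->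
    is_derive p (delta_mx 0 i : P) C2 c2 ->
    is_derive p (delta_mx 0 i : P) Ax a ->
    is_derive p (delta_mx 0 i : P) Au au ->
    is_derive p (delta_mx 0 i : P) (pd iv (fun q => s q 0 fW)) w -> _ :=
  fun e1 e2 e3 e4 e5 => is_derive_add (is_derive_add
    (is_derive_mul (dH i) (is_derive_inv e1 c0))
    (is_derive_opp (is_derive_mul (is_derive_mul e5 e4)
      (is_derive_inv (is_derive_mul e1 e3) (mulf_neq0 c0 a0)))))
    (is_derive_mul e2 (is_derive_inv (is_derive_sqr e1) (expf_neq0 2 c0))).
have [[e1 e2 e3 e4] _ _ _] := derive_v_coefs Dp.
have dv := dG _ _ _ _ _ _ e1 e2 e4 e3 dWv0.
split.
  rewrite (transport_v sH' act_Hv Dp dv).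
  by field_pd c0 a0.
have x1 := is_derive_indep sC1 Dp (indep_derive _ Cf_indep_x).
have x2 := is_derive_indep sC2 Dp (indep_derive _ (indep_derive _ Cf_indep_x)).
(* Writing A_ux as A_xu is what later lets this term of H_xv cancel against the one of W_uv. *)
have x4 : is_derive p (delta_mx 0 ix : P) Au (pd iu Ax p).
  apply: is_derive_eq (is_derive_pd _ sAu Dp) _.
  exact: derive_comm oD Af_smooth Dp.
rewrite (transport_x sH' act_Hv Dp (dG _ _ _ _ _ _ x1 x2 (dAxi ix) x4 (dW ix)) dv).
by field_pd c0 a0.
Qed.

End SecondOrder.

End TransformedJet.

End TransformedMetric.

(** * Transformation of the invariants and of the coefficient vectors *)

Section Covariance.
Variables (R : realType) (e : kundt_diffeo R) (s : 'rV[R]_3 -> 'rV[R]_3) (p : 'rV[R]_3).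
Local Notation P := 'rV[R]_3.
Hypothesis ss : smooth_section s.
Hypothesis hv0 : pd iv (fun q => s q 0 fh) = cst 0.
Hypothesis Wvv0 : pd iv (pd iv (fun q => s q 0 fW)) = cst 0.
Hypothesis Dp : kdom e p.
Hypothesis h0 : 0 < s p 0 fh.

Local Notation th := (jet_of 2 s p).
Local Notation th' := (jet_of 2 (act_section e s) (kmap e p)).
Local Notation c := (pd iu (Cf e) p).
Local Notation a := (pd ix (Af e) p).
Local Notation au := (pd iu (Af e) p).
Local Notation axx := (pd ix (pd ix (Af e)) p).
Local Notation axu := (pd iu (pd ix (Af e)) p).
Local Notation bx := (pd ix (Bf e) p).
Local Notation b := (bf e p).

Lemma act_pos : 0 < act_section e s (kmap e p) 0 fh.
Proof.
have [_ _ ->] := act_kmap s Dp; rewrite divr_gt0 // exprn_even_gt0 //=.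
exact: Ax_neq0.
Qed.

Lemma jet2_of (t : P -> P) q :
  [/\ [/\ jH (jet_of 2 t q) = t q 0 fH, jW (jet_of 2 t q) = t q 0 fW &
      jh (jet_of 2 t q) = t q 0 fh],
    [/\ jHvv (jet_of 2 t q) = pd iv (pd iv (fun x => t x 0 fH)) q &
      jHxv (jet_of 2 t q) = pd ix (pd iv (fun x => t x 0 fH)) q],
    [/\ jWv (jet_of 2 t q) = pd iv (fun x => t x 0 fW) q,
      jWxv (jet_of 2 t q) = pd ix (pd iv (fun x => t x 0 fW)) q &
      jWuv (jet_of 2 t q) = pd iu (pd iv (fun x => t x 0 fW)) q],
    jhx (jet_of 2 t q) = pd ix (fun x => t x 0 fh) q &
    jhu (jet_of 2 t q) = pd iu (fun x => t x 0 fh) q].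
Proof. by split; [split|split|split| |]; exact: jc_jet_of. Qed.

Lemma act_coords :
  [/\ [/\ jH th' = jH th * (c ^+ 2)^-1 + - (jW th * au * (c ^+ 2 * a)^-1)
         + (- b + au * bx * a^-1) * c^-1 + jh th * au ^+ 2 * (c ^+ 2 * a ^+ 2)^-1,
        jW th' = jW th * (c * a)^-1 + - (bx * a^-1)
         + - (2 * jh th * au * (c * a ^+ 2)^-1) &
        jh th' = jh th * (a ^+ 2)^-1],
    [/\ jHvv th' = jHvv th &
      jHxv th' = (jHxv th / c - jWxv th * au / (c * a)
       - jWv th * (axu * a - au * axx) / (c * a ^+ 2) - bx * jHvv th) / a],
    [/\ jWv th' = jWv th * a^-1,
        jWxv th' = (jWxv th / a - jWv th * axx / a ^+ 2) / a &
        jWuv th' = (jWuv th / a - jWv th * axu / a ^+ 2 - au * jWxv th') / c],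
    jhx th' = (jhx th / a ^+ 2 - 2 * jh th * axx / a ^+ 3) / a &
    jhu th' = (jhu th / a ^+ 2 - 2 * jh th * axu / a ^+ 3 - au * jhx th') / c].
Proof.
have [[-> -> ->] [-> ->] [-> -> ->] -> ->] := jet2_of s p.
have [[-> -> ->] [-> ->] [-> -> ->] -> ->] := jet2_of (act_section e s) (kmap e p).
have [EH EW Eh] := act_kmap s Dp.
have [Ehx Ehu] := act_h_derive ss hv0 Dp.
have [EWxv EWuv] := act_Wv_derive ss hv0 Wvv0 Dp.
have [EHvv EHxv] := act_Hv_derive ss hv0 Wvv0 Dp.
have EWv := act_Wv ss hv0 Dp.
split; [split|split|split| |].
- exact: EH.
- exact: EW.
- exact: Eh.
- exact: EHvv.
- exact: EHxv.
- exact: EWv.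
- exact: EWxv.
- exact: EWuv.
- exact: Ehx.
- exact: Ehu.
Qed.

Let jh0 : jh th != 0.
Proof. by have [[_ _ ->] _ _ _ _] := jet2_of s p; rewrite gt_eqF. Qed.

(** The second derivatives of A cancel inside [I2b], [K2aW] and [K2bW]. In [Qreg] the remaining
    terms with A_u and B_x cancel against those of W'. *)
Lemma act_invariants : jWv th != 0 -> I2a th != 0 ->
  [/\ [/\ jWv th' = jWv th / a, I2a th' = I2a th, I1 th' = I1 th & I2b th' = I2b th],
    K2aW th' = (K2aW th / c - bx * I2a th) / a,
    Qreg th' = Qreg th / (c * a),
    K2bW th' = K2bW th / (c * a) - au * jh th * I2b th / (c * a ^+ 2) &
    Rreg th' = (- I2b th * jh th * b + K2bW th * bx + Rreg th / c) / (c * a ^+ 2)].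
Proof.
rewrite /Rreg /Qreg /I2b /K2aW /K2bW /I1 /I2a.
have [[-> -> ->] [-> ->] [-> -> ->] -> ->] := act_coords.
move: (jH th) (jW th) (jh th) (jHvv th) (jHxv th) (jWv th) (jWxv th) (jWuv th)
  (jhx th) (jhu th) jh0 => H W h Hvv Hxv Wv Wxv Wuv hx hu h0' Wv0 Hvv0.
move: (C1_neq0 Dp) (Ax_neq0 Dp).
move: c a au axx axu bx b => C A U Axx Axu X B C0 A0.
split; first split; field.
all: by rewrite ?C0 ?A0 ?h0' ?Wv0 ?Hvv0.
Qed.

Lemma coef_law x y z x' y' z' : x' = x * c -> y' = x * au + y * a ->
  z' = x * b + y * bx + z / c ->
  forall j, \sum_(i < 3) row3 x y z 0 i * 'D_(delta_mx 0 i : P) (kmap e) p 0 j =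
    row3 x' y' z' 0 j.
Proof.
move=> -> -> -> j; rewrite (row3_sum _ _ _ (fun i => 'D_(delta_mx 0 i : P) (kmap e) p 0 j)).
have [-> -> ->] := derive_kmap Dp.
move: (C1_neq0 Dp); move: c a au bx b => C A U X B C0.
by elim/case3: j; rewrite !mxE /=; ring.
Qed.

End Covariance.

Lemma scale_row3 (R : realType) (k x y z : R) :
  k *: row3 x y z = row3 (k * x) (k * y) (k * z).
Proof. by apply/rowP; elim/case3; rewrite !mxE. Qed.

(** The quotient of [Qreg] by [jWv] acquires the factor 1/C', which is the one by which the
    v-direction is scaled. *)
Lemma nabla1_covariant (R : realType) : coef_covariant (nabla1 R).
Proof.
move=> e s p ss Dp hv0 Wvv0 h0 /= [Wv0 Hvv0 I2b0].
have [[EWv EHvv EI1 EI2b] _ EQ _ _] := act_invariants ss hv0 Wvv0 Dp h0 Wv0 Hvv0.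
have c0 := C1_neq0 Dp; have a0 := Ax_neq0 Dp.
split; first exact: act_pos.
  by rewrite EWv EHvv EI2b; split=> //; rewrite mulf_neq0 // invr_eq0.
apply: coef_law => //; rewrite ?mul0r ?add0r //.
rewrite EWv EHvv EI2b EI1 EQ.
move: (I1 _) (I2a _) (I2b _) (Qreg _) (jWv _) Wv0 Hvv0 I2b0 => I1 I2a I2b Q Wv.
move: c0 a0; move: (pd iu (Cf e) p) (pd ix (Af e) p) => c a c0 a0 Wv0 Hvv0 I2b0.
by field; rewrite c0 a0 Wv0 Hvv0 I2b0.
Qed.

(** The inverse of W_v acquires the factor A_x, and the shift of [K2aW] by B_x I2a supplies the
    v-component of the image of the x-direction. *)
Lemma nabla2_covariant (R : realType) : coef_covariant (nabla2 R).
Proof.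
move=> e s p ss Dp hv0 Wvv0 h0 /= [Wv0 Hvv0].
have [[EWv EHvv EI1 EI2b] EK _ _ _] := act_invariants ss hv0 Wvv0 Dp h0 Wv0 Hvv0.
have c0 := C1_neq0 Dp; have a0 := Ax_neq0 Dp.
split; first exact: act_pos.
  by rewrite EWv EHvv; split=> //; rewrite mulf_neq0 // invr_eq0.
pose th := jet_of 2 s p; rewrite !scale_row3.
apply: coef_law => //; rewrite EWv ?EHvv ?EK -/th;
  move: (K2aW th) (I2a th) (jWv th) Wv0 Hvv0 => K I2a Wv;
  move: c0 a0; move: (pd iu (Cf e) p) (pd ix (Af e) p) (pd iu (Af e) p)
  (pd ix (Bf e) p) (bf e p) => c a au bx b c0 a0 Wv0 Hvv0.
all: by field; rewrite ?c0 ?a0 ?Wv0 ?Hvv0.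
Qed.

(** The scalar factor is multiplied by C' A_x^2, which clears the denominators of [K2bW] and [Rreg];
    their correction terms are the x- and v-components of the images of the u- and x-directions. *)
Lemma nabla3_covariant (R : realType) : coef_covariant (nabla3 R).
Proof.
move=> e s p ss Dp hv0 Wvv0 h0 /= [Wv0 Hvv0 Q0].
have [[EWv EHvv EI1 EI2b] _ EQ EK ER] := act_invariants ss hv0 Wvv0 Dp h0 Wv0 Hvv0.
have [[_ _ Eh] _ _ _ _] := act_coords ss hv0 Wvv0 Dp.
have c0 := C1_neq0 Dp; have a0 := Ax_neq0 Dp.
have I10 : I1 (jet_of 2 s p) != 0.
  have [[_ _ Ej] _ _ _ _] := jet2_of s p.
  by rewrite /I1 Ej mulf_neq0 ?expf_neq0 // invr_eq0 gt_eqF.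
split; first exact: act_pos.
  by rewrite EWv EHvv EQ; split=> //; rewrite mulf_neq0 // invr_eq0 ?mulf_neq0.
pose th := jet_of 2 s p; rewrite !scale_row3.
apply: coef_law => //; rewrite EWv EHvv EI1 EQ ?EI2b ?Eh ?EK ?ER -/th;
  move: (K2bW th) (I1 th) (I2a th) (I2b th) (Qreg th) (Rreg th) (jh th) (jWv th)
    Wv0 Hvv0 Q0 I10 => K I1 I2a I2b Q Rr h Wv;
  move: c0 a0; move: (pd iu (Cf e) p) (pd ix (Af e) p) (pd iu (Af e) p)
  (pd ix (Bf e) p) (bf e p) => c a au bx b c0 a0 Wv0 Hvv0 Q0 I10.
all: by field; rewrite ?c0 ?a0 ?Wv0 ?Hvv0 ?Q0 ?I10.
Qed.

(** * Independence *)

Section Generic.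
Variable R : realType.
Local Notation P := 'rV[R]_3.
Implicit Type th : jet R 2.

Definition regular_jets : set (jet R 2) := [set th | [/\ kundt_eq th,
  jWv th != 0, I2a th != 0, I2b th != 0 & Qreg th != 0]].

Lemma regular_jets_independent : independent_on (@nabla R) regular_jets.
Proof.
move=> th [kth Wv0 Hvv0 I2b0 Q0].
have h0 : jh th != 0 by case: kth; rewrite /Jpi /= => h0 _ _ _; rewrite gt_eqF.
have I10 : I1 th != 0 by rewrite mulf_neq0 ?invr_eq0 // expf_neq0.
have nE : [/\ nabla R iu = nabla1 R, nabla R ix = nabla2 R & nabla R iv = nabla3 R].
  by [].
have [n1 n2 n3] := nE.
split; first by elim/case3; rewrite ?n1 ?n2 ?n3 /=.
rewrite -kermx_eq0; apply/rowV0P => v /sub_kermxP vM.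
have E j : v 0 iu * hcoef (nabla1 R) th 0 j + v 0 ix * hcoef (nabla2 R) th 0 j
    + v 0 iv * hcoef (nabla3 R) th 0 j = 0.
  have := congr1 (fun M : P => M 0 j) vM; rewrite [LHS]mxE sum3 [RHS]mxE => <-.
  by congr (_ * _ + _ * _ + _ * _); rewrite [RHS]mxE.
(* Only [nabla3] has a u-component, and of the other two only [nabla2] has an x-component, so the
   coefficients vanish one after another. *)
have := E iu; rewrite /= !scale_row3 !row3_fH !mulr0 !add0r => /eqP.
rewrite mulf_eq0 [X in _ || X](negPf _) ?orbF => [/eqP v3|]; last first.
  apply: mulf_neq0; last by rewrite oppr_eq0 mulf_neq0.
  apply: mulf_neq0; last by rewrite mul1r invr_eq0 mulf_neq0.
  by apply: mulf_neq0; [rewrite mulf_neq0 // pnatr_eq0|rewrite invr_eq0].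
have := E ix; rewrite v3 /= !scale_row3 !row3_fW !mulr0 mul0r !add0r addr0 => /eqP.
rewrite mulr1 mulf_eq0 invr_eq0 (negPf Wv0) orbF => /eqP v2.
have := E iv; rewrite v3 v2 /= !row3_fh !mul0r !addr0 => /eqP.
rewrite mulf_eq0 [X in _ || X](negPf _) ?orbF => [/eqP v1|]; last first.
  apply: mulf_neq0; last by apply: mulf_neq0; rewrite ?invr_eq0.
  by apply: mulf_neq0; rewrite ?invr_eq0 //; apply: mulf_neq0.
by apply/rowP; elim/case3; rewrite mxE.
Qed.

(** The case distinction copies that of [jc], so that the two agree for every multi-index. *)
Definition jet_var (a : 'I_3) (n : mindex) : mpoly.mpoly (3 * #|midx 2|) R :=
  if [pick s : midx 2 | mexp s == n] is Some s
  then mpoly.mpolyX R (mpoly.mnm1 (mxvec_index a (enum_rank s))) else 0.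

Lemma meval_jet_var th a n :
  mpoly.meval (fun i => mxvec th.2 0 i) (jet_var a n) = jc th a n.
Proof.
rewrite /jet_var /jc; case: pickP => [s _|_]; last exact: mpoly.meval0.
by rewrite mpoly.mevalXU mxvecE.
Qed.

(* [I2b_num] and [Q_num] are h^2 I2b and W_v^2 h Q. *)
Definition I2b_num : mpoly.mpoly (3 * #|midx 2|) R :=
  jet_var fW (0, 0, 1)%N * jet_var fh (0, 1, 0)%N
  - 2 * jet_var fh (0, 0, 0)%N * jet_var fW (0, 1, 1)%N.

Definition Q_num : mpoly.mpoly (3 * #|midx 2|) R :=
  2 * jet_var fH (0, 0, 2)%N * (jet_var fW (0, 0, 1)%N * jet_var fh (1, 0, 0)%N
    - 2 * jet_var fh (0, 0, 0)%N * jet_var fW (1, 0, 1)%N) * jet_var fh (0, 0, 0)%N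
  + I2b_num * (jet_var fH (0, 1, 1)%N - jet_var fW (1, 0, 1)%N)
  - jet_var fH (0, 0, 2)%N * I2b_num * jet_var fW (0, 0, 0)%N.

Definition regular_poly : mpoly.mpoly (3 * #|midx 2|) R :=
  jet_var fW (0, 0, 1)%N * jet_var fH (0, 0, 2)%N * I2b_num * Q_num.

Lemma meval_regular_poly th (B := jWv th * jhx th - 2 * jh th * jWxv th) :
  mpoly.meval (fun i => mxvec th.2 0 i) regular_poly = jWv th * jHvv th * B *
    (2 * jHvv th * (jWv th * jhu th - 2 * jh th * jWuv th) * jh th
     + B * (jHxv th - jWuv th) - jHvv th * B * jW th).
Proof.
rewrite /regular_poly /Q_num /I2b_num.
by rewrite !(mpoly.mevalM, mpoly.mevalB, mpoly.mevalD, mpoly.meval1, meval_jet_var).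
Qed.

Lemma regular_jetsE th : kundt_eq th -> regular_jets th <->
  mpoly.meval (fun i => mxvec th.2 0 i) regular_poly != 0.
Proof.
move=> kth.
have h0 : jh th != 0 by case: kth; rewrite /Jpi /= => h0 _ _ _; rewrite gt_eqF.
rewrite meval_regular_poly; set B := jWv th * jhx th - _; set N := _ - _ * jW th.
have EB : I2b th = B / jh th ^+ 2 by [].
(* [Qreg] divides by [I1], so its denominator can be cleared only once W_v is known to be nonzero,
   which both directions provide. *)
have EN : jWv th != 0 -> Qreg th = N / (jWv th ^+ 2 * jh th).
  move=> Wv0; rewrite /Qreg EB /K2bW /K2aW /I1 /I2a /N; move: {N EB}B => B'.
  move: (jWv th) (jh th) (jHvv th) (jhu th) (jWuv th) (jHxv th) (jW th) Wv0 h0.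
  by move=> a b c d f g k a0 b0; field; rewrite a0 b0.
rewrite !mulf_eq0 !negb_or; split.
  move=> [_ Wv0 Hvv0]; rewrite EB EN // !mulf_eq0 !negb_or => /andP[B0 _] /andP[N0 _].
  by rewrite Wv0 Hvv0 B0 N0.
move=> /andP[/andP[/andP[Wv0 Hvv0] B0] N0]; split=> //.
  by rewrite EB mulf_neq0 ?invr_eq0 // expf_neq0.
by rewrite EN // mulf_neq0 ?invr_eq0 // mulf_neq0 // expf_neq0.
Qed.

(** With W_v = h_x = H_vv = 1, H_xv = W + 1 and all other derivatives 0, the numerator of I2b is 1
    and that of Q is (W + 1) - W = 1, so [regular_poly] takes the value 1 whatever [y] is. *)
Definition witness_coord (y : P) (a : 'I_3) (n : mindex) : R :=
  if n == (0, 0, 0)%N then y 0 a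
  else if a == fH then (n == (0, 0, 2)%N)%:R + (n == (0, 1, 1)%N)%:R * (y 0 fW + 1)
  else if a == fW then (n == (0, 0, 1)%N)%:R
  else (n == (0, 1, 0)%N)%:R.

Definition witness (p y : P) : jet R 2 :=
  (p, \matrix_(a, c) witness_coord y a (mexp (enum_val (A := midx 2) c))).

Lemma jc_witness p y a n : (mdeg n <= 2)%N -> jc (witness p y) a n = witness_coord y a n.
Proof. by move=> /mexp_surj[s <-]; rewrite jcE mxE enum_rankK. Qed.

Lemma witness_fiber (p y : P) : 0 < y 0 fh ->
  (@kundt_fiber R 2 p y `&` regular_jets) (witness p y).
Proof.
move=> y0; have kth : kundt_eq (witness p y).
  split; first by rewrite /Jpi /= jc_witness.
  - move=> i j l le; rewrite jc_witness // /witness_coord /=.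
    by rewrite !xpair_eqE !andbF.
  - move=> i j l le; rewrite jc_witness // /witness_coord /=.
    by rewrite !xpair_eqE !andbF.
  (* H_vvv has order 3, so this condition is void on 2-jets. *)
  - by move=> i j l; rewrite /mdeg /= !addnS.
split; first by split=> // a; rewrite jc_witness.
apply/regular_jetsE => //.
rewrite meval_regular_poly.
rewrite /jWv /jHvv /jhx /jh /jWxv /jhu /jWuv /jHxv /jW !jc_witness //.
rewrite /witness_coord /= !(mul0r, mulr0, addr0, add0r, subr0, mulr1, mul1r).
by rewrite addrAC subrr add0r oner_neq0.
Qed.

Lemma zariski_open_regular_jets : zariski_open regular_jets.
Proof.
split=> [th [] //|p y y0]; split; last by exists (witness p y); exact: witness_fiber.
exists [set regular_poly] => th [kth _ _].
rewrite regular_jetsE //; split=> [H|[_ -> //]].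
by exists regular_poly.
Qed.

End Generic.

Theorem proposition14 (R : realType) :
  [/\ G_invariant (nabla1 R), G_invariant (nabla2 R) & G_invariant (nabla3 R)] /\
  exists O : set (jet R 2), zariski_open O /\ independent_on (@nabla R) O.
Proof.
split.
  split; apply: coef_covariant_invariant.
  - exact: nabla1_covariant.
  - exact: nabla2_covariant.
  - exact: nabla3_covariant.
exists (@regular_jets R); split; first exact: zariski_open_regular_jets.
exact: regular_jets_independent.
Qed.
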